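(* Let $T>0$, $L>0$. Let $V$ be bounded and Lipschitz continuous on $[0,\infty)$ with $V(k)\ge0$ for all $k\ge0$. Let $\bar k\in L^\infty([0,\infty);[0,\infty))$ be $C^2$ smooth and supported on $[0,L]$. Let $\phi\in L^\infty([0,T]\times[0,\infty);[0,\infty))$ be $C^2$ smooth, supported on $[0,T]\times[0,L]$, with $\int_0^\infty\phi(t,x)\,dx=1$ and $\phi(t,0)>0$ for all $t\in[0,T]$. Let $f\in L^\infty([0,T];[0,\infty))$ be the exact inflow rates, let $k$ be the strong solution of $$\partial_tk(t,x)-V\left(\int_0^\infty k(t,y)w(y)\,dy\right)\partial_xk(t,x)=f(t)\phi(t,x),\qquad k(0,x)=\bar k(x),\qquad w=\frac1L\mathbf 1_{[0,L]},$$ on $[0,T]\times[0,\infty)$, and let $k^\sigma(\cdot,0)$ be noisy observation data on $[0,T]$ with noise level $\sigma=\|k(\cdot,0)-k^\sigma(\cdot,0)\|_{L^\infty}$. Let $\{f_n\}_{n=0}^{N-1}$ be the reconstruction obtained from $k^\sigma(\cdot,0)$ by the explicit scheme given in the context, with time step $\Delta t=T/N$. Then with the choice $\Delta t=\sigma^{1/2}$, the following error estimate holds: $$\sup_{0\le n\le N-1}\left|f_n-\frac1{\Delta t}\int_{t_n}^{t_{n+1}}f(t)\,dt\right|\le C\sigma^{1/2},$$ where the constant $C$ depends on $T,L,V,\bar\delta,\phi_{\min,0}^{-1},\|f\|_{L^\infty},\|\phi\|_{W^{2,\infty}},\|\bar k\|_{W^{2,\infty}}$.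
   Context: Here $\bar\delta=\int_0^\infty\bar k(x)\,dx$ and $\phi_{\min,0}=\min_{t\in[0,T]}\phi(t,0)$; norms are over $[0,T]$, $[0,\infty)$ or $[0,T]\times[0,\infty)$ according to the domain of the function. The strong solution is the unique Lipschitz continuous function satisfying the equation and the initial condition pointwise. Scheme: let $t_n=n\Delta t$ for $n=0,\dots,N$, with $\Delta t=T/N$; set $\xi_0=0$, $\delta_0=\bar\delta$, and for $n=1,\dots,N$ define successively $$\xi_n=\sum_{m=0}^{n-1}V\left(\frac{\delta_m}L\right)\Delta t,$$ $$\begin{aligned}\delta_n=&\frac1{\phi(t_n,0)}\left(k^\sigma(t_n,0)-\bar k(\xi_n)+\bar\delta\phi(0,\xi_n)\right)-\frac1{\phi(t_n,0)}\sum_{m=0}^{n-1}V\left(\frac{\delta_m}L\right)k^\sigma(t_m,0)\,\phi(t_m,\xi_n-\xi_m)\,\Delta t\\&+\frac1{\phi(t_n,0)}\sum_{m=0}^{n-1}\delta_m\left(\phi(t_{m+1},\xi_n-\xi_{m+1})-\phi(t_m,\xi_n-\xi_m)\right),\end{aligned}$$ and finally, for $n=0,\dots,N-1$, $$f_n=\frac{\delta_{n+1}-\delta_n}{\Delta t}+V\left(\frac{\delta_n}L\right)k^\sigma(t_n,0).$$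
   Formalization: The noise level σ is the supremum of |k(t,0) − k^σ(t,0)| over all t in [0,T], not the essential supremum, since the scheme samples k^σ at the points t_n and changing a single sample would otherwise break the estimate. *)

(* Defs.v *)
From HB Require Import structures.
From mathcomp Require Import all_boot all_order all_algebra.
From mathcomp Require Import all_classical all_reals all_analysis.

Set Implicit Arguments.
Unset Strict Implicit.
Unset Printing Implicit Defensive.

Import Order.TTheory GRing.Theory Num.Theory.
Import numFieldNormedType.Exports.

Local Open Scope classical_set_scope.
Local Open Scope ring_scope.

Notation leb := (@lebesgue_measure _).
Notation leb2 := (@lebesgue_measure _ \x @lebesgue_measure _)%E.

Section Domains.
Context {R : realType}.

Definition halfline : set R := `[0, +oo[.
Definition halfline_int : set R := `]0, +oo[.
Definition strip (T : R) : set (R * R) := `[0, T] `*` `[0, +oo[.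
Definition strip_int (T : R) : set (R * R) := `]0, T[ `*` `]0, +oo[.

End Domains.

Section Linfty.
Context {R : realType} {d : measure_display} {X : measurableType d}.
Variable m : {measure set X -> \bar R}.

Definition Linfty_norm (D : set X) (g : X -> R) : \bar R :=
  Lnorm m +oo%E (EFin \o (g \_ D)).

Definition Linfty (D : set X) (g : X -> R) : Prop :=
  measurable_fun D g /\ (Linfty_norm D g < +oo)%E.

End Linfty.

(* A function is C^2 on a closed domain D with interior U when it is C^2 in U
   and it and its derivatives of order at most 2 extend continuously to D.  All
   derivatives are taken at points of U, so values off D play no role. *)
Section Smoothness.
Context {R : realType}.

Definition extends_continuously {X : topologicalType} (U D : set X)
    (g : X -> R) : Prop :=
  exists h : X -> R, {within D, continuous h} /\ (forall z, U z -> g z = h z).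

Definition C2_halfline (g : R -> R) : Prop :=
  [/\ {within halfline, continuous g},
      (forall x, halfline_int x -> derivable g x 1 /\ derivable (derive1 g) x 1),
      extends_continuously halfline_int halfline (derive1 g)
    & extends_continuously halfline_int halfline (derive1 (derive1 g))].

Definition dt (g : R -> R -> R) (t x : R) : R := derive1 (fun s => g s x) t.
Definition dx (g : R -> R -> R) (t x : R) : R := derive1 (g t) x.

Definition partials_exist (U : set (R * R)) (g : R -> R -> R) : Prop :=
  forall t x, U (t, x) ->
    derivable (fun s => g s x) t 1 /\ derivable (g t) x 1.

Definition C2_strip (T : R) (g : R -> R -> R) : Prop :=
  let U := strip_int T in
  let ext (h : R -> R -> R) :=
    extends_continuously U (strip T) (fun z => h z.1 z.2) in
  [/\ {within strip T, continuous (fun z : R * R => g z.1 z.2)},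
      [/\ partials_exist U g, partials_exist U (dt g)
        & partials_exist U (dx g)],
      ext (dt g) /\ ext (dx g)
    & [/\ ext (dt (dt g)), ext (dt (dx g)), ext (dx (dt g))
        & ext (dx (dx g))]].

(* W^{2,oo} norms, as the maximum of the L^oo norms of the derivatives of order
   at most 2.  They are used for C^2 functions only, so the weak derivatives
   are the classical ones. *)
Definition W2infty_halfline (g : R -> R) : \bar R :=
  \big[Order.max/0%E]_(h <- [:: g; derive1 g; derive1 (derive1 g)])
    Linfty_norm leb halfline_int h.

Definition W2infty_strip (T : R) (g : R -> R -> R) : \bar R :=
  \big[Order.max/0%E]_(h <- [:: g; dt g; dx g;
                                dt (dt g); dt (dx g); dx (dx g)])
    Linfty_norm leb2 (strip_int T) (fun z => h z.1 z.2).

End Smoothness.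

Section Model.
Context {R : realType}.
Implicit Types (T L : R) (V kbar f : R -> R) (phi k : R -> R -> R).

(* V is a function on [0, oo), represented by V : R -> R whose values at
   negative arguments are irrelevant: it is only evaluated through V^+, its
   constant extension.  This makes the scheme meaningful when the noise makes
   some delta_m negative. *)
Definition Vplus V (s : R) : R := V (Num.max s 0).

Definition weight L (y : R) : R := L^-1 * \1_(`[0, L] : set R) y.

Definition nonlocal L k (t : R) : R :=
  \int[leb]_(y in halfline) (k t y * weight L y).

(* f is only L^oo and k only Lipschitz, hence the equation holds at almost
   every (t, x). *)
Definition strong_solution T L V f phi kbar k : Prop :=
  [/\ [lipschitz k z.1 z.2 | z in (strip T : set (R * R))],
      (forall x, 0 <= x -> k 0 x = kbar x)
    & \forall z \ae leb2, strip_int T z ->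
        [/\ derivable (fun s => k s z.2) z.1 1, derivable (k z.1) z.2 1
          & dt k z.1 z.2 - Vplus V (nonlocal L k z.1) * dx k z.1 z.2
            = f z.1 * phi z.1 z.2]].

Definition total_mass kbar : R := \int[leb]_(x in halfline) kbar x.

(* A minimum as soon as phi is continuous on the strip. *)
Definition phi_min0 T phi : R := inf [set phi t 0 | t in `[0, T]].

(* The scheme samples the noisy data pointwise, so the noise level is the
   supremum, not the essential supremum, of the error. *)
Definition noise_level T (g gs : R -> R) : \bar R :=
  ereal_sup [set `|g t - gs t|%:E | t in `[0, T]].

Section Scheme.
Variables (T L : R) (V kbar : R -> R) (phi : R -> R -> R) (ks : R -> R).
Variable N : nat.

Definition time_step : R := T / N%:R.
Definition time (n : nat) : R := n%:R * time_step.

Record explicit_scheme (xi delta : nat -> R) : Prop := ExplicitScheme {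
  scheme_xi0 : xi 0%N = 0;
  scheme_delta0 : delta 0%N = total_mass kbar;
  scheme_xi : forall n, (1 <= n <= N)%N ->
    xi n = \sum_(0 <= m < n) Vplus V (delta m / L) * time_step;
  scheme_delta : forall n, (1 <= n <= N)%N ->
    delta n =
      (phi (time n) 0)^-1
        * (ks (time n) - kbar (xi n) + total_mass kbar * phi 0 (xi n))
      - (phi (time n) 0)^-1
        * \sum_(0 <= m < n) Vplus V (delta m / L) * ks (time m)
            * phi (time m) (xi n - xi m) * time_step
      + (phi (time n) 0)^-1
        * \sum_(0 <= m < n) delta m
            * (phi (time m.+1) (xi n - xi m.+1) - phi (time m) (xi n - xi m))
}.

Definition inflow_rec (delta : nat -> R) (n : nat) : R :=
  (delta n.+1 - delta n) / time_step + Vplus V (delta n / L) * ks (time n).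

End Scheme.
End Model.

(* Main.v *)
Require Import Defs.
From HB Require Import structures.
From mathcomp Require Import all_boot all_order all_algebra.
From mathcomp Require Import all_classical all_reals all_analysis.
From mathcomp Require Import measurable_realfun ess_sup_inf.
From mathcomp Require Import ring lra.
Import Order.TTheory GRing.Theory Num.Theory.
Import numFieldNormedType.Exports.
Local Open Scope classical_set_scope.
Local Open Scope ring_scope.

(** Let D(t) be the mass of k(t,.) on [0,L], v(s) = V(s/L) and X(t) the integral of
    v(D) over [0,t].  Along the characteristics x = b - X(t) the solution is explicit,
    which gives the trace at x = 0 and the balance of mass ([solution_identities]):
      k(t,0) = kbar(X(t)) + int_0^t f(s) phi(s, X(t) - X(s)) ds,
      D' = f - v(D) k(.,0).
    Put G_n for the integral of f over the n-th step and g_n for tau times the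
    reconstructed rate f_n, so that g_n = delta_(n+1) - delta_n + v(delta_n) ks_n tau.
    Summation by parts turns the scheme into a discrete copy of the first identity,
    with g_n in the place of G_n.

    The error is read off the increments of the two identities from step n to step
    n + 1.  The newest rate enters with the factor phi(t_(n+1),0), which is bounded
    below; the noise enters with at most three times sigma = tau^2.  The other terms
    are increments of phi over one step multiplied by tau, or differences of two
    increments of kbar or phi.  With two bounded derivatives they cost tau^2, or tau
    times an error already made ([scheme_error]).  Therefore
      |g_n - G_n| <= c (tau^2 + tau * accumulated errors),
    and the errors of delta and xi obey recursions of the same form.  Gronwall's
    inequality bounds the accumulated errors by O(tau), hence |g_n - G_n| = O(tau^2)
    ([error_recursion_bound]); the theorem is this bound divided by tau = sqrt sigma.

    The constant must not see the Lipschitz constant of k.  It does not, because the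
    bounds on k(.,0) and on D are derived from the two identities, whose right-hand
    sides involve only the norms of the data ([trace_bound], [trace_lipschitz],
    [mass_lipschitz]).

    The equation holds almost everywhere and k is merely Lipschitz with partial
    derivatives, so there is no chain rule along characteristics.  The identities
    are proved for the primitive of k(t,.) instead: its time derivative is found by
    dominated convergence of difference quotients ([mass_balance]), and along a
    characteristic its increments over a time h are known up to O(h^2), which
    determines it ([quadratic_increments_constant], [mass_along_characteristic]). *)

Set Implicit Arguments.
Unset Strict Implicit.
Unset Printing Implicit Defensive.

(** * Elementary inequalities and a discrete Gronwall argument *)

Section Elementary.
Context {R : realType}.

Lemma arch_le0 (r c : R) : (forall n : nat, r * n.+1%:R <= c) -> r <= 0.
Proof.
move=> rc; rewrite leNgt; apply/negP => r0.
have c0 : 0 <= c by apply: le_trans (rc 0%N); rewrite mulr_ge0// ltW.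
have := archi_boundP (divr_ge0 c0 (ltW r0)).
set n := Num.bound _; rewrite ltr_pdivrMr// => h.
have := rc n; rewrite leNgt => /negP; apply.
by rewrite mulrC (lt_le_trans h)// ler_wpM2r ?(ltW r0)// ler_nat.
Qed.

(** Cutting [a, b] into n equal pieces bounds |g b - g a| by C (b - a)^2 / n.  This
    replaces a derivative for functions whose increments are easier to control. *)
Lemma quadratic_increments_constant (g : R -> R) (a b C : R) : a <= b ->
  (forall t h, a <= t -> 0 <= h -> t + h <= b -> `|g (t + h) - g t| <= C * h ^+ 2) ->
  g b = g a.
Proof.
move=> ab gC; apply/eqP; rewrite -subr_eq0 -normr_le0.
apply: (@arch_le0 _ (C * (b - a) ^+ 2)) => n.
pose h := (b - a) / n.+1%:R.
have h0 : 0 <= h by rewrite divr_ge0// subr_ge0.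
have hn : h * n.+1%:R = b - a by rewrite /h divfK.
have tele m : (m <= n.+1)%N ->
    `|g (a + h * m%:R) - g a| <= C * h ^+ 2 * m%:R.
  elim: m => [|m IH] mn; first by rewrite !mulr0 addr0 subrr normr0.
  rewrite -(subrK (g (a + h * m%:R)) (g (a + h * m.+1%:R))) -addrA.
  apply: le_trans (ler_normD _ _) _; rewrite -natr1 !mulrDr !mulr1 [leRHS]addrC.
  apply: lerD (IH (ltnW mn)).
  rewrite addrA; apply: gC; [by rewrite lerDl mulr_ge0 | by [] |].
  rewrite -addrA -[X in _ + X <= _]addr0 -addrA -lerBrDl addr0 -hn.
  by rewrite -[X in _ + X <= _]mulr1 -mulrDr natr1 ler_wpM2l// ler_nat.
have := tele _ (leqnn n.+1); rewrite hn (addrC a) subrK => /(ler_wpM2r (ler0n _ n.+1)).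
move/le_trans; apply.
by have -> : C * (b - a) ^+ 2 = C * h ^+ 2 * n.+1%:R * n.+1%:R by rewrite -hn; ring.
Qed.

(** Each step multiplies [Z n + tau] by at most [1 + c * tau]. *)
Lemma discrete_gronwall (Z : nat -> R) (c tau T : R) (N : nat) :
  0 <= c -> 0 <= tau -> N%:R * tau <= T -> Z 0%N <= 0 ->
  (forall n, (n < N)%N -> Z n.+1 <= Z n + c * tau * (Z n + tau)) ->
  forall n, (n <= N)%N -> Z n + tau <= tau * expR (c * T).
Proof.
move=> c0 tau0 NT Z0 step n nN.
have ct0 : 0 <= c * tau by rewrite mulr_ge0.
have : Z n + tau <= tau * (1 + c * tau) ^+ n.
  elim: n nN => [|n IH] nN; first by rewrite expr0 mulr1 gerDr.
  apply: le_trans (lerD (step _ nN) (lexx tau)) _.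
  rewrite exprSr mulrA.
  have h := IH (ltnW nN).
  have := ler_wpM2r ct0 h.
  by move: (_ ^+ n) h => y h; lra.
move/le_trans; apply; apply: ler_wpM2l => //.
apply: (@le_trans _ _ (expR (c * tau) ^+ n)).
  by rewrite lerXn2r ?nnegrE ?addr_ge0 ?expR_ge0// expR_ge1Dx.
rewrite -expRM_natr ler_expR -mulrA ler_wpM2l// mulrC (le_trans _ NT)//.
by rewrite ler_wpM2r// ler_nat.
Qed.

Lemma normr_le_sum_increments (x : nat -> R) n : x 0%N = 0 ->
  `|x n| <= \sum_(0 <= m < n) `|x m.+1 - x m|.
Proof.
move=> x0; elim: n => [|n IH]; first by rewrite x0 normr0 big_geq.
rewrite big_nat_recr//= -[X in `|X|](subrK (x n)).
by apply: le_trans (ler_normD _ _) _; rewrite addrC; exact: lerD.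
Qed.

(** [a] is the error of the rates, [x] and [e] those of the displacement and of the
    mass.  The sum of the [a m] and of the total variations of [x] and [e] satisfies
    one Gronwall recursion and is O(tau); every [a n] is tau times such a sum, and so
    gains a second factor tau. *)
Lemma error_recursion_bound (a x e : nat -> R) (H tau T : R) (N : nat) :
  0 <= H -> 0 <= tau -> N%:R * tau <= T -> x 0%N = 0 -> e 0%N = 0 ->
  (forall n, 0 <= a n) ->
  (forall n, (n < N)%N -> `|x n.+1 - x n| <= H * tau * (`|e n| + tau)) ->
  (forall n, (n < N)%N -> `|e n.+1 - e n| <= a n + H * tau * (`|e n| + tau)) ->
  (forall n, (n < N)%N ->
    a n <= H * (tau ^+ 2 + `|x n.+1 - x n|
       + tau * \sum_(0 <= m < n) `|x m.+1 - x m| + tau * \sum_(0 <= m < n) a m)) ->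
  forall n, (n < N)%N ->
    a n <= (2 * H + H * H) * expR ((4 * H + 2 * H * H + 2 * H) * T) * tau ^+ 2.
Proof.
move=> H0 tau0 NT x0 e0 a0 hx he ha.
pose S (n : nat) : R := \sum_(0 <= m < n) a m.
pose Y (n : nat) : R := \sum_(0 <= m < n) `|x m.+1 - x m|.
pose W (n : nat) : R := \sum_(0 <= m < n) `|e m.+1 - e m|.
have S0 n : 0 <= S n by apply: sumr_ge0.
have Y0 n : 0 <= Y n by apply: sumr_ge0.
have W0 n : 0 <= W n by apply: sumr_ge0.
pose Z (n : nat) : R := S n + Y n + W n.
have Ht : 0 <= H * tau by rewrite mulr_ge0.
have eZ n : `|e n| + tau <= Z n + tau.
  rewrite lerD2r /Z (le_trans (normr_le_sum_increments n e0))//.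
  by rewrite lerDr addr_ge0.
have xZ n : (n < N)%N -> `|x n.+1 - x n| <= H * tau * (Z n + tau).
  by move=> /hx /le_trans; apply; rewrite ler_wpM2l.
have aZ n : (n < N)%N -> a n <= (2 * H + H * H) * tau * (Z n + tau).
  move=> nN; apply: le_trans (ha _ nN) _.
  have h1 := ler_wpM2l H0 (xZ _ nN).
  have : H * (tau * (Y n + S n)) <= H * (tau * (Z n)).
    by rewrite !ler_wpM2l// /Z addrC lerDl.
  have : 0 <= H * (tau * Z n) by rewrite !mulr_ge0// !addr_ge0.
  have : 0 <= H * tau ^+ 2 by rewrite mulr_ge0 ?sqr_ge0.
  rewrite -/(S n) -/(Y n) !expr2 => ? ? ?; nra.
have Zstep n : (n < N)%N ->
    Z n.+1 <= Z n + (4 * H + 2 * H * H + 2 * H) * tau * (Z n + tau).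
  move=> nN; have h1 := aZ _ nN; have h2 := xZ _ nN.
  have h3 : `|e n.+1 - e n| <= a n + H * tau * (Z n + tau).
    by apply: le_trans (he _ nN) _; rewrite lerD2l ler_wpM2l.
  rewrite /Z /S /Y /W !big_nat_recr//= -/(S n) -/(Y n) -/(W n) -/(Z n).
  have -> : S n + a n + (Y n + `|x n.+1 - x n|) + (W n + `|e n.+1 - e n|) =
    Z n + (a n + `|x n.+1 - x n| + `|e n.+1 - e n|) by rewrite /Z; ring.
  by rewrite lerD2l; move: (Z n) h1 h2 h3 => z; lra.
have Zb := @discrete_gronwall Z _ tau T N _ tau0 NT _ Zstep.
move=> n nN; apply: le_trans (aZ _ nN) _.
have HH : 0 <= H * H by rewrite mulr_ge0.
have -> : (2 * H + H * H) * expR ((4 * H + 2 * H * H + 2 * H) * T) * tau ^+ 2 =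
  (2 * H + H * H) * tau * (tau * expR ((4 * H + 2 * H * H + 2 * H) * T)) by ring.
apply: ler_wpM2l; first by apply: mulr_ge0 => //; lra.
by apply: Zb; [lra|rewrite /Z /S /Y /W !big_geq// !addr0|exact: ltnW].
Qed.
End Elementary.

(** * Integrals over segments *)

(** Sealed, so that [ring] and unification treat an integral as an atom. *)
HB.lock Definition segint {R : realType} (a b : R) (g : R -> R) : R :=
  \int[leb]_(x in `[a, b]) g x.
Canonical segint_unlockable := Unlockable segint.unlock.

Section SegmentIntegral.
Context {R : realType}.
Implicit Types (g : R -> R) (a b c : R).

Lemma segintE a b g : segint a b g = \int[leb]_(x in `[a, b]) g x.
Proof. by rewrite unlock. Qed.

(** A class of integrands stable under sums and products which contains the
    continuous functions as well as a bounded measurable inflow. *)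
Definition locally_bounded_measurable g :=
  measurable_fun [set: R] g /\
  forall a b, exists M, forall x, a <= x <= b -> `|g x| <= M.
Local Notation lbm := locally_bounded_measurable.

Lemma continuous_lbm g : continuous g -> lbm g.
Proof.
move=> cg; split; first exact: continuous_measurable_fun.
move=> a b; have : compact (g @` `[a, b]).
  apply: continuous_compact; last exact: segment_compact.
  exact: continuous_subspaceT.
move=> /compact_bounded[M [_ hM]]; exists (M + 1) => x xab.
by apply: (hM (M + 1)); [rewrite ltrDl|exists x => //=; rewrite in_itv].
Qed.

Lemma cst_lbm r : lbm (fun=> r).
Proof. by split=> // a b; exists `|r|. Qed.

Lemma lbmD g1 g2 : lbm g1 -> lbm g2 -> lbm (fun x => g1 x + g2 x).
Proof.
move=> [m1 b1] [m2 b2]; split; first exact: measurable_funD.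
move=> a b; have [M1 h1] := b1 a b; have [M2 h2] := b2 a b.
exists (M1 + M2) => x xab; apply: le_trans (ler_normD _ _) _.
by apply: lerD; [exact: h1|exact: h2].
Qed.

Lemma lbmM g1 g2 : lbm g1 -> lbm g2 -> lbm (fun x => g1 x * g2 x).
Proof.
move=> [m1 b1] [m2 b2]; split; first exact: measurable_funM.
move=> a b; have [M1 h1] := b1 a b; have [M2 h2] := b2 a b.
exists (M1 * M2) => x xab; rewrite normrM.
by apply: ler_pM => //; [exact: h1|exact: h2].
Qed.

Lemma lbmN g : lbm g -> lbm (fun x => - g x).
Proof.
move=> [m1 b1]; split; first exact: measurableT_comp.
by move=> a b; have [M h] := b1 a b; exists M => x xab; rewrite normrN h.
Qed.

Lemma lbmB g1 g2 : lbm g1 -> lbm g2 -> lbm (fun x => g1 x - g2 x).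
Proof. by move=> h1 h2; apply: lbmD h1 (lbmN h2). Qed.

Lemma lbm_integrable g a b : lbm g -> leb.-integrable `[a, b] (EFin \o g).
Proof.
move=> [mg bg]; apply: measurable_bounded_integrable => //.
- by rewrite /= lebesgue_measure_itv/=; case: ifPn => // _; rewrite -EFinB ltry.
- exact: measurable_funTS.
have [M h] := bg a b; exists M; split; first exact: num_real.
move=> y My x /=; rewrite in_itv/= => xab.
by apply: le_trans (h _ xab) (ltW My).
Qed.

Lemma segint_cst a b r : a <= b -> segint a b (fun=> r) = r * (b - a).
Proof.
move=> ab; rewrite !segintE Rintegral_cst//= lebesgue_measure_itv/=.
case: ltP => [_|]; first by rewrite -EFinB.
by rewrite lee_fin => ba; have -> : a = b by [apply/eqP; rewrite eq_le ab]; rewrite subrr.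
Qed.

Lemma segintxx a g : segint a a g = 0.
Proof. by rewrite segintE set_itv1 Rintegral_set1. Qed.

Lemma segint_empty a b g : b < a -> segint a b g = 0.
Proof. by move=> ba; rewrite segintE set_itv_ge ?Rintegral_set0// bnd_simp -ltNge. Qed.

Lemma eq_segint a b g1 g2 : (forall x, a <= x <= b -> g1 x = g2 x) ->
  segint a b g1 = segint a b g2.
Proof.
by move=> h; rewrite !segintE; apply: eq_Rintegral => x; rewrite inE /= in_itv/=; exact: h.
Qed.

Lemma segintD a b g1 g2 : lbm g1 -> lbm g2 ->
  segint a b (fun x => g1 x + g2 x) = segint a b g1 + segint a b g2.
Proof. by move=> h1 h2; rewrite !segintE RintegralD//; exact: lbm_integrable. Qed.

Lemma segintB a b g1 g2 : lbm g1 -> lbm g2 ->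
  segint a b (fun x => g1 x - g2 x) = segint a b g1 - segint a b g2.
Proof. by move=> h1 h2; rewrite !segintE RintegralB//; exact: lbm_integrable. Qed.

Lemma segintZ a b r g : lbm g ->
  segint a b (fun x => r * g x) = r * segint a b g.
Proof. by move=> h; rewrite !segintE RintegralZl//; exact: lbm_integrable. Qed.

Lemma segint_split a b c g : lbm g -> a <= b -> b <= c ->
  segint a c g = segint a b g + segint b c g.
Proof.
move=> h ab bc; have := @Rintegral_itvB R g (BLeft a) (BRight c) b.
move=> /(_ (lbm_integrable _ _ h)); rewrite !bnd_simp => /(_ ab bc).
rewrite Rintegral_itv_obnd_cbnd; last first.
  apply: integrableS (lbm_integrable b c h) => //.
  by apply: subset_itvr; rewrite bnd_simp.
by rewrite !segintE => <-; rewrite addrC subrK.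
Qed.

Lemma le_segint a b g1 g2 : lbm g1 -> lbm g2 ->
  (forall x, a <= x <= b -> g1 x <= g2 x) -> segint a b g1 <= segint a b g2.
Proof.
by move=> h1 h2 h; rewrite !segintE; apply: le_Rintegral => //; exact: lbm_integrable.
Qed.

Lemma segint_bound a b g M : lbm g -> a <= b ->
  (forall x, a <= x <= b -> `|g x| <= M) -> `|segint a b g| <= M * (b - a).
Proof.
move=> h ab hM; rewrite -(segint_cst M ab) ler_norml.
rewrite -mulN1r -segintZ; last exact: cst_lbm.
apply/andP; split; apply: le_segint => //; rewrite ?mulN1r;
  (try exact: cst_lbm) => x /hM; rewrite ler_norml ?mulN1r => /andP[] //.
Qed.

Lemma segint_near a b g r M : lbm g -> a <= b ->
  (forall x, a <= x <= b -> `|g x - r| <= M) ->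
  `|segint a b g - r * (b - a)| <= M * (b - a).
Proof.
move=> h ab hM; rewrite -(segint_cst r ab) -segintB//; last exact: cst_lbm.
by apply: segint_bound => //; apply: lbmB => //; exact: cst_lbm.
Qed.

Lemma segint_near_weighted a b f g r M F : lbm f -> lbm g -> a <= b -> 0 <= F ->
  (forall x, a <= x <= b -> `|f x| <= F) ->
  (forall x, a <= x <= b -> `|g x - r| <= M) ->
  `|segint a b (fun x => f x * g x) - r * segint a b f| <= F * M * (b - a).
Proof.
move=> hf hg ab F0 hF hM.
rewrite -segintZ// -segintB//; [|exact: lbmM|by apply: lbmM => //; exact: cst_lbm].
apply: segint_bound => //.
  by apply: lbmB; apply: lbmM => //; exact: cst_lbm.
move=> x xab; rewrite (mulrC r) -mulrBr normrM.
by apply: ler_pM => //; [exact: hF|exact: hM].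
Qed.

(** Convergence is asked for in the open interval only: the equation says nothing on
    the boundary of the strip, and the two end points are negligible. *)
Lemma segint_dominated_cvg a b (gn : nat -> R -> R) g M :
  (forall n, measurable_fun [set: R] (gn n)) -> lbm g ->
  (forall n x, a <= x <= b -> `|gn n x| <= M) ->
  {ae leb, forall x, a < x < b -> gn n x @[n --> \oo] --> g x} ->
  segint a b (gn n) @[n --> \oo] --> segint a b g.
Proof.
move=> mgn hg hM cv.
have ig := lbm_integrable a b hg.
have [ba|ab] := ltP b a.
  have e h : segint a b h = 0 by exact: segint_empty.
  rewrite e (_ : (fun n => segint a b (gn n)) = cst 0); first exact: cvg_cst.
  by apply/funext => n; exact: e.
have := @dominated_convergence _ _ R leb `[a, b]%classic (measurable_itv _)
  (fun n => EFin \o gn n) (EFin \o g) (cst M%:E).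
case.
- by move=> n; apply/measurable_EFinP; apply: measurable_funTS; exact: mgn.
- by apply/measurable_EFinP; apply: measurable_funTS; case: hg.
- have nab : {ae leb, forall x, x != a /\ x != b}.
    exists [set a; b]; split.
    + by apply: measurableU; exact: measurable_set1.
    + apply/eqP; rewrite eq_le measure_ge0 andbT.
      apply: le_trans (measureU2 _ _ _) _; do ?exact: measurable_set1.
      rewrite /= -[X in (_ <= X)%E]adde0.
      by have /= -> := lebesgue_measure_set1 a; have /= -> := lebesgue_measure_set1 b.
    + move=> x /= /not_andP[] /negP; rewrite negbK => /eqP ->; by [left|right].
  move: cv nab; apply: (@filterS2 _ _ (ae_filter_ringOfSetsType leb)) => x h [xa xb] /=; rewrite in_itv/= => /andP[ax xb'].
  by apply/cvg_EFin; [exact: nearW|apply: h; rewrite !lt_neqAle eq_sym xa xb ax].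
- by apply: (lbm_integrable a b (cst_lbm M)).
- by apply: aeW => x n /=; rewrite in_itv/= => xab; rewrite lee_fin hM.
move=> _ _ h; rewrite segintE; under eq_fun do rewrite segintE; apply: fine_cvg.
by rewrite fineK; [exact: h|exact: integrable_fin_num].
Qed.

End SegmentIntegral.
Notation lbm := locally_bounded_measurable.

(** * The fundamental theorem of calculus for Lipschitz functions *)

Section LipschitzFTC.
Context {R : realType}.
Implicit Types (g : R -> R) (a b : R).

Lemma lipschitz_fun_continuous g K :
  (forall x y, `|g x - g y| <= K * `|x - y|) -> continuous g.
Proof.
move=> gK x; apply/cvgrPdist_lt => e e0.
have K1 : 0 < `|K| + 1 by rewrite ltr_pwDr.
near=> y; apply: le_lt_trans (gK _ _) _.
apply: (@le_lt_trans _ _ ((`|K| + 1) * `|x - y|)).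
  by rewrite ler_wpM2r// (le_trans (ler_norm _))// lerDl.
rewrite -ltr_pdivlMl//; near: y.
apply: (@cvgr_dist_lt _ _ _ (nbhs x) _ idfun x); first exact: cvg_id.
by rewrite mulr_gt0// invr_gt0.
Unshelve. all: by end_near. Qed.

Lemma continuous_shiftr g h : continuous g -> continuous (fun s => g (s + h)).
Proof.
by move=> cg x; apply: (@continuous_comp _ _ _ (fun s => s + h) g);
  [apply: continuousD; [exact: id|exact: cst_continuous]|exact: cg].
Qed.

(** As functions of the upper limit, both sides have the increment
    [g (t + h) * d] up to O(d^2). *)
Lemma segint_shift g K a b h : (forall x y, `|g x - g y| <= K * `|x - y|) ->
  0 <= K -> a <= b -> segint a b (fun s => g (s + h)) = segint (a + h) (b + h) g.
Proof.
move=> gK K0 ab; have cg := lipschitz_fun_continuous gK.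
have lg := continuous_lbm cg.
have lgh := continuous_lbm (continuous_shiftr (h := h) cg).
pose P t := segint a t (fun s => g (s + h)) - segint (a + h) (t + h) g.
suff : P b = P a by rewrite /P !segintxx subrr => /eqP; rewrite subr_eq0 => /eqP.
apply: (@quadratic_increments_constant _ _ _ _ (2 * K)) => // t d at0 d0 _.
have td : t <= t + d by rewrite lerDl.
have -> : P (t + d) - P t = (segint t (t + d) (fun s => g (s + h)) - g (t + h) * (t + d - t)) -
   (segint (t + h) (t + d + h) g - g (t + h) * (t + d + h - (t + h))).
  rewrite /P (@segint_split _ a t (t + d))//.
  rewrite (@segint_split _ (a + h) (t + h) (t + d + h))// ?lerD2r//.
  ring.
apply: le_trans (ler_normB _ _) _.
have -> : 2 * K * d ^+ 2 = K * d * (t + d - t) + K * d * (t + d + h - (t + h)) by ring.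
apply: lerD; apply: segint_near => //; rewrite ?lerD2r// => s /andP[s1 s2];
  apply: le_trans (gK _ _) _; rewrite ler_wpM2l//.
  by rewrite ger0_norm; lra.
by rewrite ger0_norm; lra.
Qed.

Lemma segint_increment g K a b h : (forall x y, `|g x - g y| <= K * `|x - y|) ->
  0 <= K -> a <= b -> 0 <= h ->
  `|segint a b (fun s => g (s + h) - g s) - h * (g b - g a)| <= 2 * K * h ^+ 2.
Proof.
move=> gK K0 ab h0; have cg := lipschitz_fun_continuous gK.
have lg := continuous_lbm cg.
have lgh := continuous_lbm (continuous_shiftr (h := h) cg).
rewrite segintB// (segint_shift _ gK)//.
have e1 := segint_split lg (lerD ab (lexx 0)) (_ : b + 0 <= b + h).
have ah : a <= a + h by rewrite lerDl.
have bh : b <= b + h by rewrite lerDl.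
have e : segint (a + h) (b + h) g - segint a b g - h * (g b - g a) =
  (segint b (b + h) g - g b * (b + h - b)) - (segint a (a + h) g - g a * (a + h - a)).
  have := segint_split lg ab bh.
  rewrite (segint_split lg ah (_ : a + h <= b + h)) ?lerD2r// => e2.
  have -> : segint (a + h) (b + h) g =
    segint a b g + segint b (b + h) g - segint a (a + h) g by rewrite -e2; ring.
  ring.
rewrite e; apply: le_trans (ler_normB _ _) _.
have -> : 2 * K * h ^+ 2 = K * h * (b + h - b) + K * h * (a + h - a) by ring.
apply: lerD; apply: segint_near => // s /andP[s1 s2];
  apply: le_trans (gK _ _) _; rewrite ler_wpM2l//.
  by rewrite ger0_norm; lra.
by rewrite ger0_norm; lra.
Qed.

Lemma invSn_cvg0 : (fun n => n.+1%:R^-1 : R) @ \oo --> (0 : R).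
Proof. exact: cvg_harmonic. Qed.

Lemma cvg_of_harmonic_bound (u : nat -> R) l C :
  (forall n, `|u n - l| <= C * n.+1%:R^-1) -> u n @[n --> \oo] --> l.
Proof.
move=> h; apply/cvgrPdist_le => e e0.
have : (C * n.+1%:R^-1 @[n --> \oo] --> C * 0).
  by apply: cvgM; [exact: cvg_cst|exact: invSn_cvg0].
rewrite mulr0 => /cvgrPdist_le /(_ _ e0).
apply: filterS => n; rewrite sub0r normrN => h2; rewrite distrC.
by apply: le_trans (h n) (le_trans (ler_norm _) _).
Qed.

(** By translation, the integral of the difference quotient is the difference of the
    averages of [g] over two short intervals starting at [b] and [a]. *)
Lemma difference_quotient_cvg g K a b : (forall x y, `|g x - g y| <= K * `|x - y|) ->
  0 <= K -> a <= b ->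
  segint a b (fun s => (g (s + n.+1%:R^-1) - g s) * n.+1%:R) @[n --> \oo] --> g b - g a.
Proof.
move=> gK K0 ab; have cg := lipschitz_fun_continuous gK.
apply: (@cvg_of_harmonic_bound _ _ (2 * K)) => n.
rewrite (_ : segint a b _ = n.+1%:R * segint a b (fun s => g (s + n.+1%:R^-1) - g s)); last first.
  rewrite -segintZ; first by apply: eq_segint => x _; rewrite mulrC.
  by apply: lbmB; apply: continuous_lbm => //; exact: continuous_shiftr.
have n0 : 0 < n.+1%:R :> R by [].
have := @segint_increment g K a b n.+1%:R^-1 gK K0 ab.
rewrite invr_ge0 => /(_ (ltW n0)) h.
rewrite [X in `|X|](_ : _ = n.+1%:R * (segint a b (fun s => g (s + n.+1%:R^-1) - g s)
    - n.+1%:R^-1 * (g b - g a))); last by rewrite mulrBr mulrA divff ?gt_eqF// mul1r.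
rewrite normrM normr_nat; apply: le_trans (ler_wpM2l (ltW n0) h) _.
rewrite le_eqVlt; apply/orP; left; apply/eqP.
by move: (n.+1%:R) n0 => y /gt_eqF /negbT y0; field.
Qed.

Lemma difference_quotient_lbm g n : continuous g ->
  lbm (fun s => (g (s + n.+1%:R^-1) - g s) * n.+1%:R).
Proof.
move=> cg; apply: lbmM; last exact: cst_lbm.
by apply: lbmB; apply: continuous_lbm => //; exact: continuous_shiftr.
Qed.

Lemma difference_quotient_bound g K n x : (forall x y, `|g x - g y| <= K * `|x - y|) ->
  `|(g (x + n.+1%:R^-1) - g x) * n.+1%:R| <= K.
Proof.
move=> gK; rewrite normrM normr_nat -ler_pdivlMr//; apply: le_trans (gK _ _) _.
by rewrite addrAC subrr add0r ger0_norm.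
Qed.

(** The difference quotients are bounded by [K], so their integrals converge to that
    of their almost everywhere limit; they also converge to [g b - g a]. *)
Lemma lipschitz_ftc g r K a b : (forall x y, `|g x - g y| <= K * `|x - y|) ->
  0 <= K -> a <= b -> lbm r ->
  {ae leb, forall s, a < s < b ->
     (g (s + n.+1%:R^-1) - g s) * n.+1%:R @[n --> \oo] --> r s} ->
  g b - g a = segint a b r.
Proof.
move=> gK K0 ab hr cv; have cg := lipschitz_fun_continuous gK.
have h1 := @segint_dominated_cvg _ a b (fun n s => (g (s + n.+1%:R^-1) - g s) * n.+1%:R)
  r K (fun n => (difference_quotient_lbm n cg).1) hr
  (fun n x _ => difference_quotient_bound n x gK) cv.
exact: (cvg_unique _ (difference_quotient_cvg gK K0 ab) h1).
Qed.

(** It holds across 0 as well, since the integral over an empty segment vanishes. *)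
Lemma segint_lipschitz g M x y : lbm g -> 0 <= M -> (forall s, `|g s| <= M) ->
  `|segint 0 x g - segint 0 y g| <= M * `|x - y|.
Proof.
move=> lg M0 gM.
have neg z : z < 0 -> segint 0 z g = 0.
  exact: segint_empty.
wlog xy : x y / x <= y.
  move=> h; have [/h//|/ltW/h] := leP x y.
  by rewrite distrC (distrC y).
have [y0|y0] := ltP y 0.
  by rewrite !neg ?(le_lt_trans xy)// subrr normr0 mulr_ge0.
rewrite distrC (distrC x) (ger0_norm (_ : 0 <= y - x)) ?subr_ge0//.
have [x0|x0] := ltP x 0.
  rewrite (neg x)// subr0; apply: (@le_trans _ _ (M * (y - 0))).
    exact: segint_bound.
  by rewrite ler_wpM2l// subr0 lerDl oppr_ge0 ltW.
rewrite (segint_split lg x0 xy) [X in `|X|]addrAC subrr add0r.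
exact: segint_bound.
Qed.

End LipschitzFTC.

(** * Transport along characteristics *)

Section Transport.
Context {R : realType}.

(** The measure of a set is the integral of the measures of its sections. *)
Lemma ae_sections (Q : R * R -> Prop) :
  (\forall z \ae (leb2 : set (R * R) -> \bar R), Q z) ->
  {ae (leb : set R -> \bar R), forall s, {ae (leb : set R -> \bar R), forall y, Q (s, y)}}.
Proof.
move=> [N [mN N0 QN]].
have : ae_eq leb setT ((leb : set R -> \bar R) \o xsection N) (cst 0%E).
  apply/ae_eq_integral_abs => //; first exact: measurable_fun_xsection.
  rewrite -[RHS]N0; apply: eq_integral => x _; rewrite gee0_abs//.
apply: filterS => s /= /(_ I) sN; exists (xsection N s); split => //.
- exact: measurable_xsection.
- by move=> y /= nQ; rewrite /xsection /= inE; apply: QN.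
Qed.

Variables (T K M A F : R) (k phi : R -> R -> R) (Vh f : R -> R).
Hypotheses (K0 : 0 <= K) (M0 : 0 <= M) (A0 : 0 <= A).
Hypothesis k_lip : forall t t' x x', `|k t x - k t' x'| <= K * (`|t - t'| + `|x - x'|).
Hypothesis phi_bound : forall t x, `|phi t x| <= M.
Hypothesis phi_lip :
  forall t t' x x', `|phi t x - phi t' x'| <= M * (`|t - t'| + `|x - x'|).
Hypothesis Vh_cont : continuous Vh.
Hypothesis Vh_bound : forall s, 0 <= Vh s <= A.
Hypothesis f_meas : measurable_fun setT f.
Hypothesis f_bound : forall s, `|f s| <= F.
Hypothesis pde : {ae (leb : set R -> \bar R), forall s,
  {ae (leb : set R -> \bar R), forall y, 0 < s < T -> 0 < y ->
    (k (s + n.+1%:R^-1) y - k s y) * n.+1%:R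
      - Vh s * ((k s (y + n.+1%:R^-1) - k s y) * n.+1%:R) @[n --> \oo] --> f s * phi s y}}.

Let lVh : lbm Vh. Proof. exact: continuous_lbm. Qed.
Let lf : lbm f. Proof. by split => // a b; exists F. Qed.

Let kt_lip x t t' : `|k t x - k t' x| <= K * `|t - t'|.
Proof. by apply: le_trans (k_lip _ _ _ _) _; rewrite subrr normr0 addr0. Qed.
Let kx_lip t x x' : `|k t x - k t x'| <= K * `|x - x'|.
Proof. by apply: le_trans (k_lip _ _ _ _) _; rewrite subrr normr0 add0r. Qed.
Let phit_lip x t t' : `|phi t x - phi t' x| <= M * `|t - t'|.
Proof. by apply: le_trans (phi_lip _ _ _ _) _; rewrite subrr normr0 addr0. Qed.
Let phix_lip t x x' : `|phi t x - phi t x'| <= M * `|x - x'|.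
Proof. by apply: le_trans (phi_lip _ _ _ _) _; rewrite subrr normr0 add0r. Qed.

Let lkt x : lbm (k^~ x).
Proof. by apply/continuous_lbm/(@lipschitz_fun_continuous _ _ K) => s s'; exact: kt_lip. Qed.
Let lkx t : lbm (k t).
Proof. by apply/continuous_lbm/(@lipschitz_fun_continuous _ _ K) => s s'; exact: kx_lip. Qed.
Let lphix t : lbm (phi t).
Proof. by apply/continuous_lbm/(@lipschitz_fun_continuous _ _ M) => s s'; exact: phix_lip. Qed.

(** [P x t] is the mass to the left of [x]; its rate of change is the flux through
   the ends 0 and [x] plus the inflow [f s * Phi x s] into [0, x]. *)
Let P x t := segint 0 x (k t).
Let Phi x t := segint 0 x (phi t).
Let rate x s := Vh s * (k s x - k s 0) + f s * Phi x s.

Let P_lip x t t' : 0 <= x -> `|P x t - P x t'| <= K * x * `|t - t'|.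
Proof.
move=> x0; rewrite /P -segintB//.
rewrite mulrAC -[X in _ * X]subr0; apply: segint_bound => //; first exact: lbmB.
Qed.

Let Phi_x x x' t : `|Phi x t - Phi x' t| <= M * `|x - x'|.
Proof. exact: segint_lipschitz. Qed.

Let Phi_t x t t' B : 0 <= B -> x <= B -> `|Phi x t - Phi x t'| <= M * B * `|t - t'|.
Proof.
move=> B0 xB; rewrite /Phi -segintB//.
have [x0|x0] := ltP x 0.
  by rewrite segint_empty// normr0 !mulr_ge0.
apply: (@le_trans _ _ (M * `|t - t'| * (x - 0))).
  by apply: segint_bound => //; first exact: lbmB.
by rewrite subr0 mulrAC ler_wpM2r// ler_wpM2l.
Qed.

Let lPhi x : 0 <= x -> lbm (Phi x).
Proof.
move=> x0; apply/continuous_lbm/(@lipschitz_fun_continuous _ _ (M * x)) => s s'.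
exact: Phi_t.
Qed.

Let lrate x : 0 <= x -> lbm (rate x).
Proof.
move=> x0; apply: lbmD; apply: lbmM => //; last exact: lPhi.
by apply: lbmB; exact: lkt.
Qed.

(** For almost every [s] the equation holds at almost every [y].  Integrating the
    difference quotients in [y] makes the space derivative a boundary term, and
    leaves the difference quotient of [P x] in time, whose limit is thereby known. *)
Lemma mass_balance x t1 t2 : 0 <= x -> 0 <= t1 -> t1 <= t2 -> t2 <= T ->
  P x t2 - P x t1 = segint t1 t2 (rate x).
Proof.
move=> x0 t10 t12 t2T.
apply: (@lipschitz_ftc _ (P x) (rate x) (K * x)) => //.
- by move=> s s'; exact: P_lip.
- exact: mulr_ge0.
- exact: lrate.
move: pde; apply: (@filterS _ _ (ae_filter_ringOfSetsType leb)) => s h /andP[s1 s2].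
have s0T : 0 < s < T by rewrite (le_lt_trans t10 s1) (lt_le_trans s2 t2T).
pose dxk n y := (k s (y + n.+1%:R^-1) - k s y) * n.+1%:R.
pose dtk n y := (k (s + n.+1%:R^-1) y - k s y) * n.+1%:R.
have ldx n : lbm (dxk n).
  apply: difference_quotient_lbm; apply: (@lipschitz_fun_continuous _ _ K) => y y'.
  exact: kx_lip.
have ldt n : lbm (dtk n).
  by apply: lbmM; [exact: lbmB|exact: cst_lbm].
have c1 : segint 0 x (dxk n) @[n --> \oo] --> k s x - k s 0.
  by apply: (@difference_quotient_cvg _ (k s) K) => // y y'; exact: kx_lip.
have lfphi : lbm (fun y => f s * phi s y) by apply: lbmM; [exact: cst_lbm|].
have c2 : segint 0 x (fun y => dtk n y - Vh s * dxk n y) @[n --> \oo] -->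
    segint 0 x (fun y => f s * phi s y).
  apply: (@segint_dominated_cvg _ _ _ _ _ (K + A * K)) => //.
  - move=> n; suff [] : lbm (fun y => dtk n y - Vh s * dxk n y) by [].
    by apply: lbmB => //; apply: lbmM => //; exact: cst_lbm.
  - move=> n y _; apply: le_trans (ler_normB _ _) _; apply: lerD.
      exact: (@difference_quotient_bound _ (k^~ y) K n s (kt_lip y)).
    rewrite normrM; apply: ler_pM => //.
      by have /andP[? ?] := Vh_bound s; rewrite ger0_norm.
    exact: (@difference_quotient_bound _ (k s) K n y (kx_lip s)).
  - by move: h; apply: (@filterS _ _ (ae_filter_ringOfSetsType leb)) => y hy /andP[y0 _]; exact: hy.
rewrite segintZ// in c2.
have c3 : Vh s * segint 0 x (dxk n) + segint 0 x (fun y => dtk n y - Vh s * dxk n y)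
    @[n --> \oo] --> rate x s.
  by apply: cvgD c2; apply: cvgM c1; exact: cvg_cst.
apply: cvg_trans c3; apply: near_eq_cvg; apply: nearW => n.
have lVdx : lbm (fun y => Vh s * dxk n y) by apply: lbmM; [exact: cst_lbm|exact: ldx].
rewrite segintB// segintZ// addrC subrK /P -segintB//.
have lk : lbm (fun y => k (s + n.+1%:R^-1) y - k s y) by exact: lbmB.
rewrite mulrC -segintZ//; apply: eq_segint => y _.
by rewrite /dtk mulrC.
Qed.

Definition displacement t := segint 0 t Vh.
Local Notation xi := displacement.

Let xi_lip s t : `|xi s - xi t| <= A * `|s - t|.
Proof.
apply: segint_lipschitz => // r.
by have /andP[? ?] := Vh_bound r; rewrite ger0_norm.
Qed.

Lemma displacementB s t : 0 <= s -> s <= t -> xi t - xi s = segint s t Vh.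
Proof.
by move=> s0 st; rewrite /xi (segint_split lVh s0 st) addrAC subrr add0r.
Qed.

Lemma displacement_increment s t : 0 <= s -> s <= t -> 0 <= xi t - xi s <= A * (t - s).
Proof.
move=> s0 st; rewrite displacementB//; apply/andP; split.
  rewrite -[leLHS](mul0r (t - s)) -segint_cst//.
  apply: le_segint => //; first exact: cst_lbm.
  by move=> r _; have /andP[] := Vh_bound r.
rewrite -segint_cst//; apply: le_segint => //; first exact: cst_lbm.
by move=> r _; have /andP[] := Vh_bound r.
Qed.

Let xi_ge0 t : 0 <= xi t.
Proof.
have [t0|t0] := ltP t 0.
  by rewrite /xi segint_empty.
have /andP[+ _] := displacement_increment (lexx 0) t0.
by rewrite {2}/xi segintxx subr0.
Qed.

Let lPhixi b : lbm (fun s => Phi (b - xi s) s).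
Proof.
apply/continuous_lbm/(@lipschitz_fun_continuous _ _ (M * A + M * `|b|)) => s s'.
apply: le_trans (ler_distD (Phi (b - xi s) s') _ _) _.
rewrite mulrDl [leRHS]addrC; apply: lerD; last first.
  apply: le_trans (Phi_x _ _ _) _.
  have -> : b - xi s - (b - xi s') = xi s' - xi s by ring.
  by rewrite -mulrA ler_wpM2l// distrC.
apply: Phi_t => //; apply: le_trans (ler_norm b).
by rewrite gerDl oppr_le0.
Qed.

Let lphixi b : lbm (fun s => phi s (b - xi s)).
Proof.
apply/continuous_lbm/(@lipschitz_fun_continuous _ _ (M * (1 + A))) => s s'.
apply: le_trans (phi_lip _ _ _ _) _; rewrite -mulrA ler_wpM2l// mulrDl mul1r lerD2l.
have -> : b - xi s - (b - xi s') = xi s' - xi s by ring.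
by rewrite distrC.
Qed.

(** Between times [r] and [r + e] the mass left of the characteristic changes by the
    balance over the fixed interval [0, x], with [x] the position at time [r], minus
    the mass in the strip swept by the characteristic.  This strip has width
    [xi (r + e) - xi r], the integral of the velocity, so its mass cancels the flux
    through [x] up to O(e^2) since [k] is Lipschitz. *)
Lemma mass_along_characteristic b t : 0 <= t -> t <= T -> xi t <= b ->
  P (b - xi t) t = P b 0 + segint 0 t (fun s => f s * Phi (b - xi s) s - Vh s * k s 0).
Proof.
move=> t0 tT xib.
have lV0 : lbm (fun s => Vh s * k s 0) by apply: lbmM => //; exact: lkt.
have lfP : lbm (fun s => f s * Phi (b - xi s) s) by exact: lbmM.
have lr : lbm (fun s => f s * Phi (b - xi s) s - Vh s * k s 0) by exact: lbmB.
pose g r := P (b - xi r) r - segint 0 r (fun s => f s * Phi (b - xi s) s - Vh s * k s 0).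
suff : g t = g 0 by rewrite /g /xi !segintxx !subr0 => <-; rewrite subrK.
apply: (@quadratic_increments_constant _ _ _ _
  (A * K + K * (1 + A) * A + F * (M * A))) => // r e r0 e0 ret.
have re : r <= r + e by rewrite lerDl.
set d := xi (r + e) - xi r.
have dE : d = segint r (r + e) Vh by rewrite /d displacementB.
have /andP[d0 dA] : 0 <= d <= A * e.
  by have := displacement_increment r0 re; rewrite -/d addrAC subrr add0r.
have xire : xi (r + e) <= b.
  apply: le_trans xib; rewrite -subr_ge0.
  by have /andP[] := displacement_increment (addr_ge0 r0 e0) ret.
set x' := b - xi (r + e); set x := b - xi r.
have x'0 : 0 <= x' by rewrite subr_ge0.
have xx' : x' + d = x by rewrite /x' /x /d; ring.
have x'x : x' <= x by rewrite -xx' lerDl.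
have x0 : 0 <= x by exact: le_trans x'0 x'x.
have lVx : lbm (fun s => Vh s * k s x) by apply: lbmM => //; exact: lkt.
have lfB : lbm (fun s => f s * (Phi x s - Phi (b - xi s) s)).
  by apply: lbmM => //; apply: lbmB => //; exact: lPhi.
have -> : g (r + e) - g r =
    (segint r (r + e) (fun s => Vh s * k s x) - k r x * segint r (r + e) Vh)
    - (segint x' x (k (r + e)) - k r x * (x - x'))
    + segint r (r + e) (fun s => f s * (Phi x s - Phi (b - xi s) s)).
  rewrite /g -/x' -/x (segint_split lr r0 re).
  have m := mass_balance x0 r0 re (le_trans ret tT).
  have s1 : P x (r + e) = P x' (r + e) + segint x' x (k (r + e)) by exact: segint_split.
  have s2 : segint r (r + e) (rate x) =
      segint r (r + e) (fun s => Vh s * k s x)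
      + segint r (r + e) (fun s => f s * (Phi x s - Phi (b - xi s) s))
      + segint r (r + e) (fun s => f s * Phi (b - xi s) s - Vh s * k s 0).
    have i1 := segintD r (r + e) lVx lfB.
    have i2 := segintD r (r + e) (lbmD lVx lfB) lr.
    rewrite -i1 -i2.
    by apply: eq_segint => s _; rewrite /rate; ring.
  rewrite -dE -xx'.
  have -> : P x' (r + e) = P x r + segint r (r + e) (rate x) - segint x' x (k (r + e)).
    by rewrite -m s1; ring.
  rewrite s2 xx' -xx'; ring.
have ereE : r + e - r = e by ring.
have sr s : r <= s <= r + e -> `|s - r| <= e.
  by move=> /andP[? ?]; rewrite ger0_norm; lra.
apply: le_trans (ler_normD _ _) _.
rewrite [leRHS]mulrDl; apply: lerD; first last.
  apply: (@le_trans _ _ (F * (M * (A * e)) * (r + e - r))); last by rewrite ereE expr2 !mulrA.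
  apply: segint_bound => // s sre; rewrite normrM; apply: ler_pM => //.
  apply: le_trans (Phi_x _ _ _) _; rewrite ler_wpM2l//.
  have -> : x - (b - xi s) = xi s - xi r by rewrite /x; ring.
  by apply: le_trans (xi_lip _ _) _; rewrite ler_wpM2l// sr.
apply: le_trans (ler_normB _ _) _; rewrite mulrDl; apply: lerD.
  apply: (@le_trans _ _ (A * (K * e) * (r + e - r))); last by rewrite ereE expr2 !mulrA.
  apply: segint_near_weighted => //.
    by move=> s _; have /andP[? ?] := Vh_bound s; rewrite ger0_norm.
  by move=> s sre; apply: le_trans (kt_lip _ _ _) _; rewrite ler_wpM2l// sr.
apply: (@le_trans _ _ (K * ((1 + A) * e) * (x - x'))).
  apply: segint_near => // s /andP[s1 s2]; apply: le_trans (k_lip _ _ _ _) _.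
  rewrite ler_wpM2l// mulrDl mul1r; apply: lerD.
    by rewrite addrAC subrr add0r ger0_norm.
  by apply: le_trans dA; rewrite ler0_norm; lra.
have -> : K * (1 + A) * A * e ^+ 2 = K * ((1 + A) * e) * (A * e) by ring.
rewrite ler_wpM2l//; first by rewrite !mulr_ge0// addr_ge0.
by rewrite -xx' addrAC subrr add0r.
Qed.

(** Compare [mass_along_characteristic] for [b + h] and for [b], and divide by [h]. *)
Lemma characteristic_formula b t : 0 <= t -> t <= T -> xi t <= b ->
  k t (b - xi t) = k 0 b + segint 0 t (fun s => f s * phi s (b - xi s)).
Proof.
move=> t0 tT xib.
apply/eqP; rewrite -subr_eq0 -normr_le0.
apply: (@arch_le0 _ _ (K + K + F * M * t)) => n.
pose h : R := n.+1%:R^-1.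
have h0 : 0 < h by rewrite invr_gt0.
have hn : h * n.+1%:R = 1 by rewrite mulVf.
have bh : xi t <= b + h by apply: le_trans xib _; rewrite lerDl ltW.
have b0 : 0 <= b by exact: le_trans xib.
have lfphi : lbm (fun s => f s * phi s (b - xi s)) by exact: lbmM.
have lfP c : lbm (fun s => f s * Phi (c - xi s) s) by exact: lbmM.
have lV0 : lbm (fun s => Vh s * k s 0) by apply: lbmM => //; exact: lkt.
have e1 := mass_along_characteristic t0 tT bh.
have e2 := mass_along_characteristic t0 tT xib.
rewrite segintB// in e1; rewrite segintB// in e2.
have avg x s : 0 <= x -> `|P (x + h) s - P x s - k s x * h| <= K * h * h.
  move=> x0; have xh : x <= x + h by rewrite lerDl ltW.
  rewrite /P (segint_split (lkx s) x0 xh) (addrAC (segint 0 x _)) subrr add0r.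
  have := @segint_near _ x (x + h) (k s) (k s x) (K * h) (lkx s) xh.
  rewrite (addrAC x h) subrr add0r; apply => y /andP[y1 y2].
  by apply: le_trans (kx_lip _ _ _) _; rewrite ler_wpM2l// ger0_norm; lra.
have avgphi x s : 0 <= x -> `|Phi (x + h) s - Phi x s - h * phi s x| <= M * h * h.
  move=> x0; have xh : x <= x + h by rewrite lerDl ltW.
  rewrite /Phi (segint_split (lphix s) x0 xh) (addrAC (segint 0 x _)) subrr add0r.
  have := @segint_near _ x (x + h) (phi s) (phi s x) (M * h) (lphix s) xh.
  rewrite (addrAC x h) subrr add0r (mulrC h); apply => y /andP[y1 y2].
  by apply: le_trans (phix_lip _ _ _) _; rewrite ler_wpM2l// ger0_norm; lra.
have a1 := avg (b - xi t) t; rewrite subr_ge0 in a1; have {}a1 := a1 xib.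
have a2 := avg b 0 b0.
have a3 : `|segint 0 t (fun s => f s * (Phi (b + h - xi s) s - Phi (b - xi s) s - h * phi s (b - xi s)))|
    <= F * (M * h * h) * (t - 0).
  apply: segint_bound => //.
    apply: lbmM => //; apply: lbmB; first exact: lbmB.
    by apply: lbmM; [exact: cst_lbm|].
  move=> s /andP[s0 st]; rewrite normrM; apply: ler_pM => //.
  have -> : b + h - xi s = b - xi s + h by ring.
  apply: avgphi; rewrite subr_ge0; apply: le_trans xib; rewrite -subr_ge0.
  by have /andP[] := displacement_increment s0 st.
have a3E : segint 0 t (fun s => f s * (Phi (b + h - xi s) s - Phi (b - xi s) s - h * phi s (b - xi s)))
  = segint 0 t (fun s => f s * Phi (b + h - xi s) s) - segint 0 t (fun s => f s * Phi (b - xi s) s)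
   - h * segint 0 t (fun s => f s * phi s (b - xi s)).
  rewrite -segintZ// -segintB// -segintB//; [|exact: lbmB|by apply: lbmM => //; exact: cst_lbm].
  by apply: eq_segint => s _; ring.
rewrite a3E in a3.
set Y := k t _ - _.
have YE : Y * h = (P (b + h) 0 - P b 0 - k 0 b * h) - (P (b - xi t + h) t - P (b - xi t) t - k t (b - xi t) * h)
  + (segint 0 t (fun s => f s * Phi (b + h - xi s) s) - segint 0 t (fun s => f s * Phi (b - xi s) s)
   - h * segint 0 t (fun s => f s * phi s (b - xi s))).
  have -> : b - xi t + h = b + h - xi t by ring.
  rewrite e1 e2 /Y; ring.
have : `|Y| * h <= (K + K + F * M * t) * h * h.
  rewrite -[X in _ * X](ger0_norm (ltW h0)) -normrM YE.
  apply: le_trans (ler_normD _ _) _.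
  apply: le_trans (lerD (ler_normB _ _) (lexx _)) _.
  have -> : (K + K + F * M * t) * h * h = K * h * h + K * h * h + F * (M * h * h) * (t - 0) by ring.
  by apply: lerD a3; exact: lerD.
rewrite ler_pM2r// => /(ler_wpM2r (ler0n R n.+1)).
by move=> /le_trans; apply; rewrite -[leLHS]mulrA hn mulr1.
Qed.

End Transport.

(** * Essential bounds and difference bounds for smooth functions *)

Section EssentialBounds.
Context {R : realType}.

Lemma within_continuous_ball {X : pseudoMetricType R} (A : set X) (g : X -> R) x e :
  {within A, continuous g} -> A x -> 0 < e ->
  exists2 d, 0 < d & forall y, A y -> ball x d y -> `|g y - g x| < e.
Proof.
move=> /subspace_continuousP cg Ax e0.
have /cvgrPdist_lt /(_ e e0) := cg x Ax.
rewrite /prop_near1 /nbhs /= /within /=.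
move=> /nbhs_ballP[d /= d0 dP]; exists d => // y Ay xy.
by rewrite distrC; exact: dP.
Qed.

Lemma within_continuous_ballP {X : pseudoMetricType R} (A : set X) (g : X -> R) :
  (forall x, A x -> forall e, 0 < e ->
     exists2 d, 0 < d & forall y, A y -> ball x d y -> `|g y - g x| < e) ->
  {within A, continuous g}.
Proof.
move=> h; apply/subspace_continuousP => x Ax.
apply/cvgrPdist_lt => e e0; have [d d0 dP] := h x Ax e e0.
rewrite /prop_near1 /nbhs /= /within /=.
by apply/nbhs_ballP; exists d => //= y xy Ay; rewrite distrC; exact: dP.
Qed.

Section Norm.
Context {d : measure_display} {X : measurableType d}.
Variable m : {measure set X -> \bar R}.

Lemma Linfty_norm_le (D : set X) (g : X -> R) (B : R) : 0 <= B ->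
  (forall w, D w -> `|g w| <= B) -> (Linfty_norm m D g <= B%:E)%E.
Proof.
move=> B0 gB; rewrite /Linfty_norm unlock; case: ifPn => // _.
apply/ess_supP; apply: aeW => w /=; rewrite lee_fin patchE.
by case: ifPn => [|_]; rewrite ?normr0// inE => Dw; exact: gB.
Qed.

Lemma Linfty_norm_ae (D : set X) (g : X -> R) : (Linfty_norm m D g < +oo)%E ->
  {ae m, forall w, D w -> `|g w| <= fine (Linfty_norm m D g)}.
Proof.
move=> fin; have fE : Linfty_norm m D g = (fine (Linfty_norm m D g))%:E.
  by rewrite fineK// ge0_fin_numE// Lnorm_ge0.
move: fE; rewrite {1}/Linfty_norm {1}unlock; case: ifPn => [_|m0 _]; last first.
  exists setT; split => //; apply/eqP; rewrite eq_le measure_ge0 andbT.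
  by rewrite leNgt.
move: (fine _) => B fE.
have := ess_sup_ge m (abse \o (EFin \o (g \_ D))); rewrite fE.
apply: (@filterS _ _ (ae_filter_ringOfSetsType m)) => w /=.
by rewrite lee_fin patchE => + Dw; rewrite mem_set.
Qed.

(** If |g z| exceeded the norm, then so would |g| on the set of the hypothesis for
    some small [e], and this set is not negligible. *)
Lemma Linfty_norm_ge_at (D : set X) (g : X -> R) z :
  (forall e, 0 < e -> ~ m.-negligible [set w | D w /\ `|g w - g z| < e]) ->
  (Linfty_norm m D g < +oo)%E -> `|g z| <= fine (Linfty_norm m D g).
Proof.
move=> nn /Linfty_norm_ae; move: (fine _) => B ae; rewrite leNgt; apply/negP => Bg.
apply: (nn (`|g z| - B)); first by rewrite subr_gt0.
apply: negligibleS ae => w [Dw gw] /= /(_ Dw) gB.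
have := le_lt_trans (ler_norm _) gw; have := ler_distD (g w) (g z) 0.
rewrite !subr0 distrC; move: gw gB; move: (`|g w - g z|) (`|g w|) (`|g z|).
by move=> p q r; lra.
Qed.

End Norm.

Lemma interval_not_negligible (a b : R) : a < b ->
  ~ leb.-negligible `]a, b[.
Proof.
move=> ab /measure_negligible => /(_ (measurable_itv _)).
rewrite /= lebesgue_measure_itv/= lte_fin ab -EFinB => /eqP.
by rewrite eqe subr_eq0 gt_eqF.
Qed.

Lemma rectangle_not_negligible (a b c d : R) : a < b -> c < d ->
  ~ leb2.-negligible (`]a, b[ `*` `]c, d[).
Proof.
move=> ab cd /measure_negligible => /(_ (measurableX (measurable_itv _) (measurable_itv _))).
have /= -> := @product_measure1E _ _ (measurableTypeR R) (measurableTypeR R) R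
  leb leb `]a, b[%classic `]c, d[%classic (measurable_itv _) (measurable_itv _).
rewrite !lebesgue_measure_itv/= !lte_fin ab cd -!EFinB -EFinM => /eqP.
by rewrite eqe mulf_eq0 !subr_eq0 !gt_eqF.
Qed.


Lemma compact_bound {X : pseudoMetricType R} (D E : set X) (h : X -> R) :
  {within D, continuous h} -> E `<=` D -> compact E ->
  exists2 B, 0 <= B & forall z, E z -> `|h z| <= B.
Proof.
move=> ch ED cE; have : compact (h @` E).
  by apply: continuous_compact => //; exact: continuous_subspaceW ch.
move=> /compact_bounded[M [_ hM]]; exists (`|M| + 1); first by rewrite addr_ge0.
move=> z Ez; apply: (hM (`|M| + 1)); last by exists z.
by rewrite (le_lt_trans (ler_norm M))// ltrDl.
Qed.

(** Beyond [L] the function vanishes, and on [0, L] its continuous extension is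
    bounded by compactness. *)
Lemma halfline_norm_finite (g : R -> R) (L : R) : 0 < L ->
  extends_continuously halfline_int halfline g ->
  (forall x, L < x -> g x = 0) ->
  (Linfty_norm leb halfline_int g < +oo)%E.
Proof.
move=> L0 [h [ch gh]] g0.
have [B B0 hB] : exists2 B, 0 <= B & forall z, `[0, L]%classic z -> `|h z| <= B.
  apply: (compact_bound ch); last exact: segment_compact.
  by move=> x /=; rewrite /halfline /= !in_itv/= andbT => /andP[].
apply: le_lt_trans (ltry B); apply: Linfty_norm_le => // x xU.
have [xL|xL] := leP x L; last by rewrite g0// normr0.
rewrite gh//; apply: hB; move: xU; rewrite /halfline_int /= !in_itv/= andbT => /ltW ->.
by rewrite xL.
Qed.

Lemma halfline_norm_bound (g : R -> R) x :
  extends_continuously halfline_int halfline g ->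
  (Linfty_norm leb halfline_int g < +oo)%E -> 0 < x ->
  `|g x| <= fine (Linfty_norm leb halfline_int g).
Proof.
move=> [h [ch gh]] fin x0; apply: Linfty_norm_ge_at => // e e0.
have hx : halfline x by rewrite /halfline /= in_itv/= andbT ltW.
have [d d0 dP] := within_continuous_ball ch hx e0.
move=> neg; apply: (@interval_not_negligible (Num.max (x - d) 0) (x + d)).
  by rewrite gt_max; lra.
apply: negligibleS neg => y; rewrite /= in_itv/= gt_max => /andP[/andP[xy y0] yx].
have yU : halfline_int y by rewrite /halfline_int /= in_itv/= andbT.
have xU : halfline_int x by rewrite /halfline_int /= in_itv/= andbT.
split => //; rewrite !gh//; apply: dP.
  by rewrite /halfline /= in_itv/= andbT ltW.
by rewrite /ball /= ltr_norml; lra.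
Qed.

Lemma strip_norm_finite (T L : R) (g : R -> R -> R) : 0 < L ->
  extends_continuously (strip_int T) (strip T) (fun z => g z.1 z.2) ->
  (forall t x, 0 < t < T -> L < x -> g t x = 0) ->
  (Linfty_norm leb2 (strip_int T) (fun z => g z.1 z.2) < +oo)%E.
Proof.
move=> L0 [h [ch gh]] g0.
have [B B0 hB] : exists2 B, 0 <= B &
    forall z, (`[0, T]%classic `*` `[0, L]%classic) z -> `|h z| <= B.
  apply: (compact_bound ch); last by apply: compact_setX; exact: segment_compact.
  by move=> [t x] /=; rewrite /strip /= !in_itv/= andbT => -[? /andP[]].
apply: le_lt_trans (ltry B); apply: Linfty_norm_le => // -[t x] U.
have := U; rewrite /strip_int /= !in_itv/= andbT => -[tT x0].
have [xL|xL] := leP x L; last by rewrite g0// normr0.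
rewrite (gh (t, x))//; apply: hB; rewrite /= !in_itv/= xL (ltW x0).
by move: tT => /andP[/ltW -> /ltW ->].
Qed.

Lemma strip_norm_bound (T : R) (g : R -> R -> R) t x :
  extends_continuously (strip_int T) (strip T) (fun z => g z.1 z.2) ->
  (Linfty_norm leb2 (strip_int T) (fun z => g z.1 z.2) < +oo)%E ->
  0 < t < T -> 0 < x ->
  `|g t x| <= fine (Linfty_norm leb2 (strip_int T) (fun z => g z.1 z.2)).
Proof.
move=> [h [ch gh]] fin /andP[t0 tT] x0.
apply: (@Linfty_norm_ge_at _ (measurableTypeR R * measurableTypeR R)%type leb2 (strip_int T)
  (fun z => g z.1 z.2) (t, x)) => // e e0.
have hz : strip T (t, x) by rewrite /strip /= !in_itv/= andbT (ltW t0) (ltW tT) ltW.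
have [d d0 dP] := within_continuous_ball ch hz e0.
move=> neg; apply: (@rectangle_not_negligible (Num.max (t - d) 0) (Num.min (t + d) T)
  (Num.max (x - d) 0) (x + d)).
- by rewrite gt_max !lt_min; lra.
- by rewrite gt_max; lra.
apply: negligibleS neg => -[s y]; rewrite /= !in_itv/= !gt_max !lt_min.
move=> [/andP[/andP[ts s0] /andP[st sT]] /andP[/andP[xy y0] yx]].
have yU : strip_int T (s, y) by rewrite /strip_int /= !in_itv/= andbT s0 sT y0.
have xU : strip_int T (t, x) by rewrite /strip_int /= !in_itv/= andbT t0 tT x0.
split => //; have -> := gh _ yU; have -> := gh _ xU; apply: dP.
  by rewrite /strip /= !in_itv/= andbT (ltW s0) (ltW sT) ltW.
by split; rewrite /ball /= ltr_norml; lra.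
Qed.

Lemma derivable_lipschitz (g : R -> R) (B a b : R) : 0 <= B ->
  (forall x, Num.min a b <= x <= Num.max a b -> derivable g x 1 /\ `|derive1 g x| <= B) ->
  `|g a - g b| <= B * `|a - b|.
Proof.
move=> B0; wlog ab : a b / a <= b.
  move=> h; have /orP[/h//|/h] := le_total a b.
  by rewrite distrC (distrC a) minC maxC.
rewrite min_l// max_r// distrC (distrC a) => h.
have gd x : x \in `]a, b[ -> is_derive x 1 g (derive1 g x).
  rewrite in_itv/= => /andP[ax xb]; rewrite derive1E; apply: derivableP.
  by apply: (h x _).1; rewrite (ltW ax) (ltW xb).
have [|c cab ->] := MVT_segment ab gd.
  apply: derivable_within_continuous => x; rewrite in_itv/= => xab.
  exact: (h x xab).1.
rewrite normrM ler_wpM2r//; apply: (h c _).2.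
by move: cab; rewrite in_itv.
Qed.

Lemma derivable_shiftr (g : R -> R) d x : derivable g (x + d) 1 ->
  derivable (fun y => g (y + d)) x 1 /\ derive1 (fun y => g (y + d)) x = derive1 g (x + d).
Proof.
move=> dg; have := @is_derive_shift R x 1 d => ds.
have h : is_derive x 1 (fun y => g (y + d)) (derive1 g (x + d)).
  have dg' : is_derive (shift d x) 1 g (derive1 g (x + d)).
    by rewrite derive1E; exact: derivableP.
  by have := is_derive1_comp dg' ds; rewrite mulr1.
by case: h => h1 h2; split => //; rewrite derive1E.
Qed.

Lemma derivable_sub (g h : R -> R) x : derivable g x 1 -> derivable h x 1 ->
  derivable (fun y => g y - h y) x 1 /\
  derive1 (fun y => g y - h y) x = derive1 g x - derive1 h x.
Proof.
by move=> dg dh; split; [exact: derivableB|rewrite !derive1E deriveB].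
Qed.

(** The derivative of [z |-> g (z + d) - g z] is an increment of g'. *)
Lemma second_difference_bound (g : R -> R) B d x y : 0 <= B ->
  (forall z, 0 < z -> [/\ derivable g z 1, derivable (derive1 g) z 1
     & `|derive1 (derive1 g) z| <= B]) ->
  0 < x -> 0 < y -> 0 <= d ->
  `|(g (x + d) - g x) - (g (y + d) - g y)| <= B * d * `|x - y|.
Proof.
move=> B0 hg x0 y0 d0.
apply: (@derivable_lipschitz (fun z => g (z + d) - g z) (B * d) x y); first exact: mulr_ge0.
move=> z /andP[+ _]; rewrite ge_min => mz.
have z0 : 0 < z by case/orP: mz => /(lt_le_trans _); exact.
have zd0 : 0 < z + d by rewrite ltr_wpDr.
have [gz _ _] := hg z z0; have [gzd _ _] := hg _ zd0.
have [s1 s2] := derivable_shiftr gzd.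
have [e1 e2] := derivable_sub s1 gz; split; first exact: e1.
rewrite e2 s2.
rewrite -[X in _ * X](_ : `|z + d - z| = d); last first.
  by rewrite addrAC subrr add0r ger0_norm.
apply: (@derivable_lipschitz (derive1 g) B (z + d) z B0) => w /andP[+ _]; rewrite ge_min => mw.
have w0 : 0 < w by case/orP: mw => /(lt_le_trans _); exact.
by have [] := hg w w0.
Qed.

(** The derivative in [z] of [g s z - g t z] is an increment in time of [dx g]. *)
Lemma mixed_difference_bound (T : R) (g : R -> R -> R) B s t x y : 0 <= B ->
  (forall r z, 0 < r < T -> 0 < z ->
     [/\ derivable (g r) z 1, derivable (fun q => dx g q z) r 1 & `|dt (dx g) r z| <= B]) ->
  0 < s < T -> 0 < t < T -> 0 < x -> 0 < y ->
  `|(g s x - g t x) - (g s y - g t y)| <= B * `|s - t| * `|x - y|.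
Proof.
move=> B0 hg sT tT x0 y0.
apply: (@derivable_lipschitz (fun z => g s z - g t z) (B * `|s - t|) x y); first exact: mulr_ge0.
move=> z /andP[+ _]; rewrite ge_min => mz.
have z0 : 0 < z by case/orP: mz => /(lt_le_trans _); exact.
have [gs _ _] := hg s z sT z0; have [gt _ _] := hg t z tT z0.
have [e1 e2] := derivable_sub gs gt; split; first exact: e1.
rewrite e2.
apply: (@derivable_lipschitz (fun q => dx g q z) B s t B0) => r.
rewrite ge_min le_max => rst.
have rT : 0 < r < T by lra.
by have [] := hg r z rT z0.
Qed.

End EssentialBounds.

(** * Bounds for the data from their second-order norms *)

Section RegularData.
Context {R : realType}.

Lemma derive1_near_zero (g : R -> R) x : (\forall y \near x, g y = 0) -> derive1 g x = 0.
Proof.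
move=> g0; rewrite derive1E (@near_eq_derive _ _ _ g (cst 0) x 1) ?derive_cst//.
Qed.

Lemma derive1_zero_above (g : R -> R) L : (forall x, L < x -> g x = 0) ->
  forall x, L < x -> derive1 g x = 0.
Proof.
move=> g0 x Lx; apply: derive1_near_zero; near=> y; apply: g0; near: y.
exact: lt_nbhsr.
Unshelve. all: by end_near. Qed.

Lemma dx_zero_above (T L : R) (g : R -> R -> R) :
  (forall t x, 0 < t < T -> L < x -> g t x = 0) ->
  forall t x, 0 < t < T -> L < x -> dx g t x = 0.
Proof.
by move=> g0 t x tT Lx; apply: (@derive1_zero_above (g t) L) => // y; exact: g0.
Qed.

Lemma dt_zero_above (T L : R) (g : R -> R -> R) :
  (forall t x, 0 < t < T -> L < x -> g t x = 0) ->
  forall t x, 0 < t < T -> L < x -> dt g t x = 0.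
Proof.
move=> g0 t x /andP[t0 tT] Lx; apply: derive1_near_zero; near=> s; apply: g0 => //.
by apply/andP; split; near: s; [exact: lt_nbhsr|exact: lt_nbhsl].
Unshelve. all: by end_near. Qed.

Lemma norm_limit_le (u : nat -> R) l B :
  u n @[n --> \oo] --> l -> (forall n, `|u n| <= B) -> `|l| <= B.
Proof.
move=> ul uB; rewrite leNgt; apply/negP => Bl.
have e0 : 0 < `|l| - B by rewrite subr_gt0.
have /cvgrPdist_lt /(_ _ e0) [N _ hN] := ul.
have := hN N (leqnn N) => /= h; have := uB N.
have := ler_distD (u N) l 0; rewrite !subr0.
by move: h; move: (`|l - u N|) (`|u N|) (`|l|) => p q r; lra.
Qed.

Lemma halfline_shift_cvg (g : R -> R) x : {within halfline, continuous g} -> 0 <= x ->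
  g (x + n.+1%:R^-1) @[n --> \oo] --> g x.
Proof.
move=> cg x0; apply/cvgrPdist_lt => e e0.
have hx : halfline x by rewrite /halfline /= in_itv/= andbT.
have [d d0 dP] := within_continuous_ball cg hx e0.
have /cvgrPdist_lt /(_ d d0) := @invSn_cvg0 R; apply: filterS => n.
rewrite sub0r normrN => nd; rewrite distrC; apply: dP.
  by rewrite /halfline /= in_itv/= andbT addr_ge0.
by rewrite /ball /= opprD addrA subrr sub0r normrN.
Qed.

Lemma fine_le_bigmax (s : seq (\bar R)) :
  (forall x, x \in s -> (0 <= x)%E /\ (x < +oo)%E) ->
  [/\ (0 <= \big[Order.max/0]_(x <- s) x)%E, (\big[Order.max/0]_(x <- s) x < +oo)%E
    & forall x, x \in s -> fine x <= fine (\big[Order.max/0%E]_(x <- s) x)].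
Proof.
elim: s => [|a s IH] hs; first by rewrite big_nil; split; rewrite ?ltry.
have [m0 m1 m2] := IH (fun x xs => hs x (mem_behead (s := a :: s) xs)).
have [a0 a1] := hs a (mem_head _ _).
rewrite big_cons; move: m0 m1 m2; case: (\big[_/_]_(x <- s) x)%E => [m| |]// m0 _ m2.
case: a a0 a1 hs => [a| |]// a0 _ hs.
rewrite -EFin_max; split; rewrite ?ltry//.
  by rewrite lee_fin le_max -lee_fin a0.
move=> x; rewrite inE => /predU1P[->|/m2 /=]; rewrite /= le_max ?lexx// => ->.
by rewrite orbT.
Qed.

(** Indexed by positions, so that the members of a maximum of norms are never
    compared with each other. *)
Lemma fine_nth_le_bigmax (s : seq (\bar R)) :
  (forall i, (i < size s)%N -> (0 <= nth 0 s i)%E /\ (nth 0 s i < +oo)%E) ->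
  0 <= fine (\big[Order.max/0%E]_(x <- s) x) /\
  forall i, (i < size s)%N -> fine (nth 0%E s i) <= fine (\big[Order.max/0%E]_(x <- s) x).
Proof.
move=> hs; have [|q0 q1 q2] := @fine_le_bigmax s; last first.
  by split; [exact: fine_ge0|move=> i si; apply: q2; exact: mem_nth].
by move=> x /(nthP 0%E)[i si <-]; exact: hs.
Qed.

Lemma halfline_data (L : R) (g : R -> R) (B := fine (W2infty_halfline g)) :
  0 < L -> C2_halfline g -> (forall x, L < x -> g x = 0) ->
  [/\ 0 <= B, forall x, 0 <= x -> `|g x| <= B,
   forall x y, 0 <= x -> 0 <= y -> `|g x - g y| <= B * `|x - y|
   & forall x y d, 0 <= x -> 0 <= y -> 0 <= d ->
     `|(g (x + d) - g x) - (g (y + d) - g y)| <= B * d * `|x - y| ].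
Proof.
move=> L0 [cg dg e1 e2] g0.
have e0 : extends_continuously halfline_int halfline g by exists g.
have g1 := derive1_zero_above g0; have g2 := derive1_zero_above g1.
have f0 := halfline_norm_finite L0 e0 g0.
have f1 := halfline_norm_finite L0 e1 g1.
have f2 := halfline_norm_finite L0 e2 g2.
have p (h : R -> R) : (0 <= Linfty_norm leb halfline_int h)%E by exact: Lnorm_ge0.
have [B0 b0 b1 b2] : [/\ 0 <= B, fine (Linfty_norm leb halfline_int g) <= B,
    fine (Linfty_norm leb halfline_int (derive1 g)) <= B
    & fine (Linfty_norm leb halfline_int (derive1 (derive1 g))) <= B].
  have WE : W2infty_halfline g = \big[Order.max/0%E]_(x <- [:: Linfty_norm leb halfline_int g;
      Linfty_norm leb halfline_int (derive1 g);
      Linfty_norm leb halfline_int (derive1 (derive1 g))]) x.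
    by rewrite /W2infty_halfline !big_cons !big_nil.
  rewrite /B WE.
  have [|q0 q2] := @fine_nth_le_bigmax [:: Linfty_norm leb halfline_int g;
      Linfty_norm leb halfline_int (derive1 g);
      Linfty_norm leb halfline_int (derive1 (derive1 g))].
    move=> [_|[_|[_|//]]].
    - exact: (conj (p _) f0).
    - exact: (conj (p _) f1).
    - exact: (conj (p _) f2).
  by split; [exact: q0|exact: (q2 0%N isT)|exact: (q2 1%N isT)|exact: (q2 2%N isT)].
have h0 (x : R) : 0 < x -> `|g x| <= B.
  by move=> x0; apply: le_trans b0; exact: halfline_norm_bound.
have U (x : R) : 0 < x -> halfline_int x by move=> x0; rewrite /halfline_int /= in_itv/= andbT.
have c (n : nat) (x : R) : 0 <= x -> 0 < x + n.+1%:R^-1 :> R by move=> x0; rewrite ltr_wpDl.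
split=> //.
- move=> x x0; apply: (norm_limit_le (halfline_shift_cvg cg x0)) => n; exact: h0 (c _ _ x0).
- move=> x y x0 y0.
  apply: (norm_limit_le (cvgB (halfline_shift_cvg cg x0) (halfline_shift_cvg cg y0))) => n.
  have -> : x - y = (x + n.+1%:R^-1) - (y + n.+1%:R^-1) by ring.
  apply: derivable_lipschitz => [//|z /andP[+ _]]; rewrite ge_min => mz.
  have z0 : 0 < z by case/orP: mz => /(lt_le_trans _); apply; exact: c.
  split; first by have [] := dg z (U z z0).
  by apply: le_trans b1; exact: halfline_norm_bound.
move=> x y d x0 y0 d0; have xd0 := addr_ge0 x0 d0; have yd0 := addr_ge0 y0 d0.
apply: (@norm_limit_le (fun n => (g (x + d + n.+1%:R^-1) - g (x + n.+1%:R^-1))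
    - (g (y + d + n.+1%:R^-1) - g (y + n.+1%:R^-1)))) => [|n].
  exact: (cvgB (cvgB (halfline_shift_cvg cg xd0) (halfline_shift_cvg cg x0))
    (cvgB (halfline_shift_cvg cg yd0) (halfline_shift_cvg cg y0))).
have -> : x - y = (x + n.+1%:R^-1) - (y + n.+1%:R^-1) by ring.
rewrite (addrAC x d) (addrAC y d); apply: second_difference_bound => //; do ?exact: c.
move=> z z0; have [d1 d2] := dg z (U z z0); split=> //.
by apply: le_trans b2; exact: halfline_norm_bound.
Qed.

(** The points [(shrink T n t, x + eps n)] are interior to the strip and tend to
   [(t, x)].  This displacement does not increase distances and commutes with
   translations in [x]. *)
Let eps (n : nat) : R := n.+2%:R^-1.

Let eps01 n : 0 < eps n < 1.
Proof. by rewrite invr_gt0 ltr0n/= invf_lt1// ltr1n. Qed.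

Let shrink (T : R) n t := (1 - eps n) * t + eps n * (T / 2).

Let shrink_int (T : R) n t : 0 < T -> 0 <= t <= T -> 0 < shrink T n t < T.
Proof.
move=> T0 /andP[t0 tT]; rewrite /shrink; have /andP[e0 e1] := eps01 n.
have : 0 <= (1 - eps n) * t by rewrite mulr_ge0// subr_ge0 ltW.
have : (1 - eps n) * t <= (1 - eps n) * T by rewrite ler_wpM2l// subr_ge0 ltW.
have : 0 < eps n * T by rewrite mulr_gt0.
by move: (eps n) => e; lra.
Qed.

Let eps_cvg0 : eps n @[n --> \oo] --> 0.
Proof.
apply: (@cvg_of_harmonic_bound _ _ _ 1) => n; have /andP[e0 _] := eps01 n.
by rewrite subr0 ger0_norm ?(ltW e0)// mul1r lef_pV2 ?posrE// ler_nat.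
Qed.

Lemma strip_shift_cvg (T : R) (g : R -> R -> R) t x : 0 < T ->
  {within strip T, continuous (fun z : R * R => g z.1 z.2)} ->
  0 <= t <= T -> 0 <= x ->
  g (shrink T n t) (x + eps n) @[n --> \oo] --> g t x.
Proof.
move=> T0 cg tT x0; apply/cvgrPdist_lt => e e0.
have hx : strip T (t, x) by rewrite /strip /= !in_itv/= andbT.
have [d d0 dP] := within_continuous_ball cg hx e0.
have dT : 0 < d / (T + 1) by rewrite divr_gt0// addr_gt0.
have /cvgrPdist_lt /(_ _ dT) := eps_cvg0; apply: filterS => n.
have /andP[ep0 ep1] := eps01 n.
rewrite sub0r normrN ger0_norm ?(ltW ep0)// ltr_pdivlMr ?addr_gt0// => nd.
rewrite distrC; apply: (dP (shrink T n t, x + eps n)).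
  have /andP[s0 s1] := shrink_int n T0 tT.
  split; rewrite /= in_itv/=; first by apply/andP; split; exact: ltW.
  by rewrite andbT addr_ge0// ltW.
have eT : 0 < eps n * T by rewrite mulr_gt0.
split; rewrite /ball /=.
  rewrite /shrink (_ : _ - _ = eps n * (t - T / 2)); last by ring.
  rewrite normrM (ger0_norm (ltW ep0)).
  have : `|t - T / 2| <= T by rewrite ler_norml; lra.
  by move=> /(ler_wpM2l (ltW ep0)); lra.
by rewrite opprD addrA subrr sub0r normrN ger0_norm ?(ltW ep0)//; lra.
Qed.

Lemma interior_lipschitz (T M : R) (g : R -> R -> R) s t x y : 0 <= M ->
  (forall r z, 0 < r < T -> 0 < z -> [/\ derivable (fun q => g q z) r 1,
     derivable (g r) z 1, `|dt g r z| <= M & `|dx g r z| <= M]) ->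
  0 < s < T -> 0 < t < T -> 0 < x -> 0 < y ->
  `|g s x - g t y| <= M * (`|s - t| + `|x - y|).
Proof.
move=> M0 hg sT tT x0 y0; apply: le_trans (ler_distD (g t x) _ _) _.
rewrite mulrDr; apply: lerD.
  apply: (@derivable_lipschitz R (fun r => g r x) M s t M0) => r.
  rewrite ge_min le_max => rst; have rT : 0 < r < T by lra.
  by have [h1 _ h2 _] := hg r x rT x0; split; [exact: h1|exact: h2].
apply: (@derivable_lipschitz R (g t) M x y M0) => z.
rewrite ge_min le_max => zxy; have z0 : 0 < z by lra.
by have [_ h1 _ h2] := hg t z tT z0; split; [exact: h1|exact: h2].
Qed.

Lemma interior_second_difference (T M : R) (g : R -> R -> R) s t x y d : 0 <= M ->
  (forall r z, 0 < r < T -> 0 < z -> [/\ derivable (g r) z 1,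
     derivable (fun q => dx g q z) r 1, derivable (dx g r) z 1,
     `|dt (dx g) r z| <= M & `|dx (dx g) r z| <= M]) ->
  0 < s < T -> 0 < t < T -> 0 < x -> 0 < y -> 0 <= d ->
  `|(g s (x + d) - g s x) - (g t (y + d) - g t y)| <= M * d * (`|s - t| + `|x - y|).
Proof.
move=> M0 hg sT tT x0 y0 d0.
apply: le_trans (ler_distD (g t (x + d) - g t x) _ _) _.
rewrite mulrDr; apply: lerD.
  have -> : g s (x + d) - g s x - (g t (x + d) - g t x) =
    (g s (x + d) - g t (x + d)) - (g s x - g t x) by ring.
  have xd0 : 0 < x + d by rewrite ltr_wpDr.
  have := @mixed_difference_bound R T g M s t (x + d) x M0 _ sT tT xd0 x0.
  rewrite (addrAC x d) subrr add0r (ger0_norm d0) mulrAC; apply => r z rT z0.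
  by have [h1 h2 _ h3 _] := hg r z rT z0.
apply: (@second_difference_bound R (g t) M d x y M0 _ x0 y0 d0) => z z0.
by have [h1 _ h2 _ h3] := hg t z tT z0.
Qed.

(** The derivatives are only known in the open strip, and the estimates are carried
    to its closure by moving the points inside with [shrink] and [eps]. *)
Lemma strip_closure (T M : R) (g : R -> R -> R) : 0 < T -> 0 <= M ->
  {within strip T, continuous (fun z : R * R => g z.1 z.2)} ->
  (forall t x, 0 < t < T -> 0 < x -> `|g t x| <= M) ->
  (forall s t x y, 0 < s < T -> 0 < t < T -> 0 < x -> 0 < y ->
    `|g s x - g t y| <= M * (`|s - t| + `|x - y|)) ->
  (forall s t x y d, 0 < s < T -> 0 < t < T -> 0 < x -> 0 < y -> 0 <= d ->
    `|(g s (x + d) - g s x) - (g t (y + d) - g t y)| <= M * d * (`|s - t| + `|x - y|)) ->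
  [/\ forall t x, 0 <= t <= T -> 0 <= x -> `|g t x| <= M,
   forall s t x y, 0 <= s <= T -> 0 <= t <= T -> 0 <= x -> 0 <= y ->
     `|g s x - g t y| <= M * (`|s - t| + `|x - y|)
   & forall s t x y d, 0 <= s <= T -> 0 <= t <= T -> 0 <= x -> 0 <= y -> 0 <= d ->
     `|(g s (x + d) - g s x) - (g t (y + d) - g t y)| <= M * d * (`|s - t| + `|x - y|)].
Proof.
move=> T0 M0 cg i0 i1 i2.
have cx (n : nat) (x : R) : 0 <= x -> 0 < x + eps n.
  by move=> x0; rewrite ltr_wpDl//; have /andP[] := eps01 n.
have ct (n : nat) (t : R) : 0 <= t <= T -> 0 < shrink T n t < T by exact: shrink_int.
have cst (n : nat) (s t x y : R) :
    `|shrink T n s - shrink T n t| + `|x + eps n - (y + eps n)| <= `|s - t| + `|x - y|.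
  have -> : x + eps n - (y + eps n) = x - y by ring.
  rewrite lerD2r /shrink (_ : _ - _ = (1 - eps n) * (s - t)); last by ring.
  have /andP[ep0 ep1] := eps01 n.
  by rewrite normrM ler_piMl// ger0_norm; lra.
have cv t x := @strip_shift_cvg T g t x T0 cg.
split.
- move=> t x tT x0; apply: (norm_limit_le (cv t x tT x0)) => n.
  by apply: i0; [exact: ct|exact: cx].
- move=> s t x y sT tT x0 y0.
  apply: (norm_limit_le (cvgB (cv s x sT x0) (cv t y tT y0))) => n.
  apply: le_trans (i1 _ _ _ _ (ct n _ sT) (ct n _ tT) (cx n _ x0) (cx n _ y0)) _.
  by rewrite ler_wpM2l.
move=> s t x y d sT tT x0 y0 d0; have xd0 := addr_ge0 x0 d0; have yd0 := addr_ge0 y0 d0.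
apply: (@norm_limit_le (fun n =>
    (g (shrink T n s) (x + d + eps n) - g (shrink T n s) (x + eps n))
    - (g (shrink T n t) (y + d + eps n) - g (shrink T n t) (y + eps n)))) => [|n].
  exact: (cvgB (cvgB (cv s _ sT xd0) (cv s _ sT x0)) (cvgB (cv t _ tT yd0) (cv t _ tT y0))).
rewrite (addrAC x d) (addrAC y d).
apply: le_trans (i2 _ _ _ _ _ (ct n _ sT) (ct n _ tT) (cx n _ x0) (cx n _ y0) d0) _.
by rewrite ler_wpM2l// mulr_ge0.
Qed.

Definition strip_norm (T : R) (h : R -> R -> R) : \bar R :=
  Linfty_norm leb2 (strip_int T) (fun z => h z.1 z.2).

Lemma strip_data (T L : R) (g : R -> R -> R) (M := fine (W2infty_strip T g)) :
  0 < T -> 0 < L -> C2_strip T g ->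
  (forall t x, 0 <= t <= T -> L < x -> g t x = 0) ->
  [/\ 0 <= M, forall t x, 0 <= t <= T -> 0 <= x -> `|g t x| <= M,
   forall s t x y, 0 <= s <= T -> 0 <= t <= T -> 0 <= x -> 0 <= y ->
     `|g s x - g t y| <= M * (`|s - t| + `|x - y|)
   & forall s t x y d, 0 <= s <= T -> 0 <= t <= T -> 0 <= x -> 0 <= y -> 0 <= d ->
     `|(g s (x + d) - g s x) - (g t (y + d) - g t y)| <= M * d * (`|s - t| + `|x - y|)].
Proof.
move=> T0 L0 [cg [p0 p1 p2] [e1 e2] [e3 e4 e5 e6]] z0'.
have z0 t x : 0 < t < T -> L < x -> g t x = 0.
  by move=> /andP[/ltW ? /ltW ?]; apply: z0'; apply/andP.
have e0 : extends_continuously (strip_int T) (strip T) (fun z => g z.1 z.2).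
  by exists (fun z => g z.1 z.2).
have z1 := dt_zero_above z0; have z2 := dx_zero_above z0.
have z3 := dt_zero_above z1; have z4 := dt_zero_above z2; have z6 := dx_zero_above z2.
have f0 := strip_norm_finite L0 e0 z0.
have f1 := strip_norm_finite L0 e1 z1.
have f2 := strip_norm_finite L0 e2 z2.
have f3 := strip_norm_finite L0 e3 z3.
have f4 := strip_norm_finite L0 e4 z4.
have f6 := strip_norm_finite L0 e6 z6.
have p (h : R -> R -> R) : (0 <= strip_norm T h)%E by exact: Lnorm_ge0.
have [M0 b0 b1 b2 [b4 b6]] : [/\ 0 <= M, fine (strip_norm T g) <= M,
    fine (strip_norm T (dt g)) <= M, fine (strip_norm T (dx g)) <= M
    & fine (strip_norm T (dt (dx g))) <= M /\ fine (strip_norm T (dx (dx g))) <= M].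
  pose s := [:: strip_norm T g; strip_norm T (dt g); strip_norm T (dx g);
    strip_norm T (dt (dt g)); strip_norm T (dt (dx g)); strip_norm T (dx (dx g))].
  have WE : W2infty_strip T g = \big[Order.max/0%E]_(x <- s) x.
    by rewrite /W2infty_strip /s !big_cons !big_nil.
  rewrite /M WE; have [|q0 q2] := @fine_nth_le_bigmax s.
    move=> [_|[_|[_|[_|[_|[_|//]]]]]].
    - exact: (conj (p _) f0).
    - exact: (conj (p _) f1).
    - exact: (conj (p _) f2).
    - exact: (conj (p _) f3).
    - exact: (conj (p _) f4).
    - exact: (conj (p _) f6).
  split; [exact: q0|exact: (q2 0%N isT)|exact: (q2 1%N isT)|exact: (q2 2%N isT)|].
  by split; [exact: (q2 4%N isT)|exact: (q2 5%N isT)].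
have U (t x : R) : 0 < t < T -> 0 < x -> strip_int T (t, x).
  by move=> tT x0; rewrite /strip_int /= !in_itv/= andbT.
have bd0 (t x : R) (tT : 0 < t < T) (x0 : 0 < x) : `|g t x| <= M.
  by apply: le_trans b0; exact: (@strip_norm_bound R T g t x e0 f0 tT x0).
have bd1 (t x : R) (tT : 0 < t < T) (x0 : 0 < x) : `|dt g t x| <= M.
  by apply: le_trans b1; exact: (@strip_norm_bound R T (dt g) t x e1 f1 tT x0).
have bd2 (t x : R) (tT : 0 < t < T) (x0 : 0 < x) : `|dx g t x| <= M.
  by apply: le_trans b2; exact: (@strip_norm_bound R T (dx g) t x e2 f2 tT x0).
have bd4 (t x : R) (tT : 0 < t < T) (x0 : 0 < x) : `|dt (dx g) t x| <= M.
  by apply: le_trans b4; exact: (@strip_norm_bound R T (dt (dx g)) t x e4 f4 tT x0).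
have bd6 (t x : R) (tT : 0 < t < T) (x0 : 0 < x) : `|dx (dx g) t x| <= M.
  by apply: le_trans b6; exact: (@strip_norm_bound R T (dx (dx g)) t x e6 f6 tT x0).
have [r0 r1 r2] : [/\ forall t x, 0 <= t <= T -> 0 <= x -> `|g t x| <= M,
   forall s t x y, 0 <= s <= T -> 0 <= t <= T -> 0 <= x -> 0 <= y ->
     `|g s x - g t y| <= M * (`|s - t| + `|x - y|)
   & forall s t x y d, 0 <= s <= T -> 0 <= t <= T -> 0 <= x -> 0 <= y -> 0 <= d ->
     `|(g s (x + d) - g s x) - (g t (y + d) - g t y)| <= M * d * (`|s - t| + `|x - y|)].
  apply: (@strip_closure T M g T0 M0 cg bd0) => s t x y.
    apply: (@interior_lipschitz T M g s t x y M0) => r z rT z00.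
    have [d1 d2] := p0 r z (U _ _ rT z00).
    exact: And4 d1 d2 (bd1 r z rT z00) (bd2 r z rT z00).
  move=> d; apply: (@interior_second_difference T M g s t x y d M0) => r z rT z00.
  have [_ d1] := p0 r z (U _ _ rT z00); have [d2 d3] := p2 r z (U _ _ rT z00).
  exact: And5 d1 d2 d3 (bd4 r z rT z00) (bd6 r z rT z00).
exact: And4 M0 r0 r1 r2.
Qed.

End RegularData.

(** * Comparison of the scheme with the exact Volterra equation *)

Section SchemeError.
Context {R : realType}.

Lemma summation_by_parts (u w : nat -> R) n :
  \sum_(0 <= m < n) w m.+1 * (u m.+1 - u m) =
  w n * u n - w 0%N * u 0%N - \sum_(0 <= m < n) u m * (w m.+1 - w m).
Proof.
elim: n => [|n IH]; first by rewrite !big_geq// !subrr.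
by rewrite !big_nat_recr//= IH; ring.
Qed.

Lemma norm_sum_le_const (u : nat -> R) n c : (forall m, (m < n)%N -> `|u m| <= c) ->
  `|\sum_(0 <= m < n) u m| <= n%:R * c.
Proof.
move=> h; apply: le_trans (ler_norm_sum _ _ _) _.
apply: (@le_trans _ _ (\sum_(0 <= m < n) c)).
  by apply: ler_sum_nat => m /andP[_]; exact: h.
by rewrite sumr_const_nat subn0 mulr_natl.
Qed.

Lemma increments_increasing (x : nat -> R) N : (forall n, (n < N)%N -> 0 <= x n.+1 - x n) ->
  forall m n, (m <= n)%N -> (n <= N)%N -> x m <= x n.
Proof.
move=> hx m; elim=> [|n IH]; first by rewrite leqn0 => /eqP ->.
rewrite leq_eqVlt => /predU1P[->//|mn] nN.
by apply: le_trans (IH mn (ltnW nN)) _; rewrite -subr_ge0 hx.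
Qed.

(** Passing from [d] to [d'] costs a first difference of size [|d - d'|]; what
    remains is a second difference. *)
Lemma shifted_difference_bound (g : R -> R) (H x y d d' : R) : 0 <= H ->
  (forall x y, 0 <= x -> 0 <= y -> `|g x - g y| <= H * `|x - y|) ->
  (forall x y d, 0 <= x -> 0 <= y -> 0 <= d ->
     `|(g (x + d) - g x) - (g (y + d) - g y)| <= H * d * `|x - y|) ->
  0 <= x -> 0 <= y -> 0 <= d -> 0 <= d' ->
  `|(g (x + d) - g x) - (g (y + d') - g y)| <= H * `|d - d'| + H * d' * `|x - y|.
Proof.
move=> H0 h1 h2 x0 y0 d0 d'0.
have -> : (g (x + d) - g x) - (g (y + d') - g y) =
  (g (x + d) - g (x + d')) + ((g (x + d') - g x) - (g (y + d') - g y)) by ring.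
apply: le_trans (ler_normD _ _) _; apply: lerD; last exact: h2.
apply: le_trans (h1 _ _ (addr_ge0 x0 d0) (addr_ge0 x0 d'0)) _.
by have -> : x + d - (x + d') = d - d' by ring.
Qed.

Variables (T tau H : R) (N : nat) (v kb : R -> R) (ph : R -> R -> R).
Variables (delta xi ks D X K G : nat -> R).
Let tm (n : nat) : R := n%:R * tau.
Hypotheses (H0 : 0 <= H) (tau0 : 0 <= tau) (NT : N%:R * tau = T) (tauT : tau <= T).
Hypothesis v_bound : forall s, 0 <= v s <= H.
Hypothesis v_lip : forall s s', `|v s - v s'| <= H * `|s - s'|.
Hypothesis kb_lip : forall x y, 0 <= x -> 0 <= y -> `|kb x - kb y| <= H * `|x - y|.
Hypothesis kb_lip2 : forall x y d, 0 <= x -> 0 <= y -> 0 <= d ->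
  `|(kb (x + d) - kb x) - (kb (y + d) - kb y)| <= H * d * `|x - y|.
Hypothesis ph_lip : forall s t x y, 0 <= s <= T -> 0 <= t <= T -> 0 <= x -> 0 <= y ->
  `|ph s x - ph t y| <= H * (`|s - t| + `|x - y|).
Hypothesis ph_lip2 : forall s t x y d,
  0 <= s <= T -> 0 <= t <= T -> 0 <= x -> 0 <= y -> 0 <= d ->
  `|(ph s (x + d) - ph s x) - (ph t (y + d) - ph t y)| <= H * d * (`|s - t| + `|x - y|).
Hypothesis ph_pos : forall t, 0 <= t <= T -> 1 <= H * ph t 0.
Hypothesis ks_bound : forall n, (n <= N)%N -> `|ks n| <= H.
Hypothesis K_bound : forall n, (n <= N)%N -> `|K n| <= H.
Hypothesis noise : forall n, (n <= N)%N -> `|ks n - K n| <= tau ^+ 2.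
Hypothesis G_bound : forall n, (n < N)%N -> `|G n| <= H * tau.
Hypotheses (xi0 : xi 0%N = 0) (X0 : X 0%N = 0) (delta0 : delta 0%N = D 0%N) (K0 : K 0%N = kb 0).
Hypothesis xi_step : forall n, (n < N)%N -> xi n.+1 - xi n = v (delta n) * tau.
Hypothesis X_step : forall n, (n < N)%N ->
  0 <= X n.+1 - X n <= H * tau /\ `|X n.+1 - X n - v (D n) * tau| <= H * tau ^+ 2.
Hypothesis D_step : forall n, (n < N)%N ->
  `|D n.+1 - D n - (G n - v (D n) * K n * tau)| <= H * tau ^+ 2.
Hypothesis scheme : forall n, (1 <= n <= N)%N ->
  ph (tm n) 0 * delta n = ks n - kb (xi n) + delta 0%N * ph 0 (xi n)
    - \sum_(0 <= m < n) v (delta m) * ks m * ph (tm m) (xi n - xi m) * tau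
    + \sum_(0 <= m < n) delta m * (ph (tm m.+1) (xi n - xi m.+1) - ph (tm m) (xi n - xi m)).
Hypothesis exact_step : forall n, (n < N)%N ->
  `|K n.+1 - K n - (kb (X n.+1) - kb (X n)) - ph (tm n.+1) 0 * G n
    - \sum_(0 <= m < n) (ph (tm m.+1) (X n.+1 - X m.+1) - ph (tm m.+1) (X n - X m.+1)) * G m|
  <= H * tau ^+ 2.

Let g n := delta n.+1 - delta n + v (delta n) * ks n * tau.
Let Phi n m := ph (tm m) (xi n - xi m).

Let scheme_volterra n : (1 <= n <= N)%N ->
  ks n = kb (xi n) + \sum_(0 <= m < n) (Phi n m.+1 * g m
     - (Phi n m.+1 - Phi n m) * (v (delta m) * ks m * tau)).
Proof.
move=> nN; have := scheme nN.
have := summation_by_parts delta (Phi n) n.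
have -> : Phi n n = ph (tm n) 0 by rewrite /Phi subrr.
have -> : Phi n 0 = ph 0 (xi n) by rewrite /Phi xi0 subr0 /tm mul0r.
move=> sp sc.
have -> : ks n = kb (xi n) + (ph (tm n) 0 * delta n - ph 0 (xi n) * delta 0%N
   - \sum_(0 <= m < n) delta m * (Phi n m.+1 - Phi n m)
   + \sum_(0 <= m < n) v (delta m) * ks m * ph (tm m) (xi n - xi m) * tau).
  by rewrite sc /Phi; ring.
rewrite -sp -big_split /=; congr (_ + _); apply: eq_bigr => m _.
by rewrite /g /Phi; ring.
Qed.

(** At time 0 the scheme prescribes delta and ignores the datum [ks 0], so the
   Volterra form of the scheme has a residual there, the noise at time 0. *)
Let rho n := if n is 0%N then ks 0%N - K 0%N else 0.

Let rho_bound n : (n <= N)%N -> `|rho n| <= tau ^+ 2.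
Proof. by case: n => [|n] nN; [exact: noise|rewrite normr0 sqr_ge0]. Qed.

Let volterra n : (n <= N)%N ->
  ks n = kb (xi n) + \sum_(0 <= m < n) (Phi n m.+1 * g m
     - (Phi n m.+1 - Phi n m) * (v (delta m) * ks m * tau)) + rho n.
Proof.
case: n => [|n] nN; last by rewrite addr0 -scheme_volterra.
by rewrite big_geq// xi0 /rho K0; ring.
Qed.

(** The coefficients of the known quantities [v (delta m) * ks m * tau] are second
   differences of [ph], so these terms are small and need not be compared with
   their exact counterparts. *)
Let numeric_step n : (n < N)%N ->
  ks n.+1 - ks n = kb (xi n.+1) - kb (xi n) + ph (tm n.+1) 0 * g n
    - (Phi n.+1 n.+1 - Phi n.+1 n) * (v (delta n) * ks n * tau)
    + \sum_(0 <= m < n) (Phi n.+1 m.+1 - Phi n m.+1) * g m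
    - \sum_(0 <= m < n) ((Phi n.+1 m.+1 - Phi n m.+1) - (Phi n.+1 m - Phi n m))
         * (v (delta m) * ks m * tau)
    - rho n.
Proof.
move=> nN; rewrite [in LHS](volterra nN) [in LHS](volterra (ltnW nN)) big_nat_recr//=.
have -> : \sum_(0 <= m < n) (Phi n.+1 m.+1 * g m
     - (Phi n.+1 m.+1 - Phi n.+1 m) * (v (delta m) * ks m * tau)) =
   \sum_(0 <= m < n) (Phi n m.+1 * g m
     - (Phi n m.+1 - Phi n m) * (v (delta m) * ks m * tau)) +
   (\sum_(0 <= m < n) (Phi n.+1 m.+1 - Phi n m.+1) * g m
    - \sum_(0 <= m < n) ((Phi n.+1 m.+1 - Phi n m.+1) - (Phi n.+1 m - Phi n m))
         * (v (delta m) * ks m * tau)).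
  by rewrite -sumrB -big_split /=; apply: eq_bigr => m _; ring.
have -> : Phi n.+1 n.+1 = ph (tm n.+1) 0 by rewrite /Phi subrr.
ring.
Qed.

Let x n := xi n - X n.
Let e n := delta n - D n.
Let a n := `|g n - G n|.
Let Y n := \sum_(0 <= m < n) `|x m.+1 - x m|.
Let S n := \sum_(0 <= m < n) a m.

Let tmT n : (n <= N)%N -> 0 <= tm n <= T.
Proof. by move=> nN; rewrite /tm -NT mulr_ge0//= ler_wpM2r// ler_nat. Qed.

Let tmS n : tm n.+1 - tm n = tau.
Proof. by rewrite /tm -natr1; ring. Qed.

Let xi_incr n : (n < N)%N -> 0 <= xi n.+1 - xi n <= H * tau.
Proof.
by move=> nN; rewrite xi_step//; have /andP[v0 v1] := v_bound (delta n);
  rewrite mulr_ge0//= ler_wpM2r.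
Qed.

Let xi_mono m n : (m <= n)%N -> (n <= N)%N -> 0 <= xi n - xi m.
Proof.
move=> mn nN; rewrite subr_ge0; apply: (@increments_increasing xi N) => // i iN.
by have /andP[] := xi_incr iN.
Qed.

Let X_mono m n : (m <= n)%N -> (n <= N)%N -> 0 <= X n - X m.
Proof.
move=> mn nN; rewrite subr_ge0; apply: (@increments_increasing X N) => // i iN.
by have [/andP[]] := X_step iN.
Qed.

Let forcing_bound n : (n <= N)%N -> `|v (delta n) * ks n * tau| <= H * H * tau.
Proof.
move=> nN; have /andP[v0 v1] := v_bound (delta n).
rewrite !normrM (ger0_norm v0) (ger0_norm tau0) ler_wpM2r//.
by apply: ler_pM => //; exact: ks_bound.
Qed.

Let x_step n : (n < N)%N -> `|x n.+1 - x n| <= H * tau * (`|e n| + tau).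
Proof.
move=> nN; have [_ hX] := X_step nN.
have -> : x n.+1 - x n = (v (delta n) - v (D n)) * tau - (X n.+1 - X n - v (D n) * tau).
  by rewrite mulrBl -xi_step// /x; ring.
apply: le_trans (ler_normB _ _) _.
have -> : H * tau * (`|e n| + tau) = H * `|e n| * tau + H * tau ^+ 2 by ring.
by apply: lerD => //; rewrite normrM (ger0_norm tau0) ler_wpM2r// v_lip.
Qed.

(** The product of the noise [tau ^+ 2] with the step [tau] is absorbed by
   [tau <= T]. *)
Let e_step n : (n < N)%N ->
  `|e n.+1 - e n| <= a n + (H + H * H + H * T) * tau * (`|e n| + tau).
Proof.
move=> nN; have hD := D_step nN; have /andP[v0 v1] := v_bound (delta n).
have -> : e n.+1 - e n = (g n - G n) - v (delta n) * (ks n - K n) * tau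
    - (v (delta n) - v (D n)) * K n * tau
    - (D n.+1 - D n - (G n - v (D n) * K n * tau)) by rewrite /e /g; ring.
have h1 : `|v (delta n) * (ks n - K n) * tau| <= H * tau ^+ 2 * T.
  rewrite !normrM (ger0_norm v0) (ger0_norm tau0).
  by apply: ler_pM; rewrite ?mulr_ge0//; apply: ler_pM => //; apply: noise; exact: ltnW.
have h2 : `|(v (delta n) - v (D n)) * K n * tau| <= H * `|e n| * H * tau.
  rewrite !normrM (ger0_norm tau0) ler_wpM2r//.
  by apply: ler_pM => //; apply: K_bound; exact: ltnW.
apply: le_trans (ler_normB _ _) _.
apply: le_trans (lerD (ler_normB _ _) (lexx _)) _.
apply: le_trans (lerD (lerD (ler_normB _ _) (lexx _)) (lexx _)) _.
apply: le_trans (lerD (lerD (lerD (lexx _) h1) h2) hD) _.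
have T0 : 0 <= T by exact: le_trans tauT.
have : 0 <= H * H * tau * tau by rewrite !mulr_ge0.
have : 0 <= H * tau * `|e n| by rewrite !mulr_ge0.
have : 0 <= H * T * tau * `|e n| by rewrite !mulr_ge0.
rewrite /a expr2; move: `|e n| => en ? ? ?.
rewrite -!addrA lerD2l; nra.
Qed.

Let Y_mono m n : (m <= n)%N -> Y m <= Y n.
Proof.
move=> mn; apply: (@increments_increasing Y n) => // i _.
by rewrite /Y big_nat_recr//= addrAC subrr add0r.
Qed.

Let x0 : x 0%N = 0. Proof. by rewrite /x xi0 X0 subrr. Qed.

Let increment_diff n : xi n.+1 - xi n - (X n.+1 - X n) = x n.+1 - x n.
Proof. by rewrite /x; ring. Qed.

(** The difference of [numeric_step] and [exact_step], in which [kbt], [A1], [Q]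
   and [W] are the contributions of the initial datum, of the newest known term, of
   the earlier rates and of the earlier known terms. *)
Let a_step n : (n < N)%N ->
  a n <= H * (3 + 2 * H + 2 * H ^+ 2 + H ^+ 3 * (1 + H) + T * H ^+ 4 * (1 + H)
              + T * H * (H + 2 * H ^+ 2))
         * (tau ^+ 2 + `|x n.+1 - x n| + tau * Y n + tau * S n).
Proof.
move=> nN; have nN' := ltnW nN; have T0 : 0 <= T by exact: le_trans tauT.
set dxn := `|x n.+1 - x n|.
have Yn0 : 0 <= Y n by rewrite /Y; apply: sumr_ge0 => m _.
have Sn0 : 0 <= S n by rewrite /S; apply: sumr_ge0 => m _; exact: normr_ge0.
have xin0 : 0 <= xi n by have := xi_mono (leq0n n) nN'; rewrite xi0 subr0.
have Xn0 : 0 <= X n by have := X_mono (leq0n n) nN'; rewrite X0 subr0.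
have /andP[d0 dH] := xi_incr nN; have [/andP[d'0 d'H] _] := X_step nN.
set d := xi n.+1 - xi n in d0 dH; set d' := X n.+1 - X n in d'0 d'H.
have xiE : xi n.+1 = xi n + d by rewrite /d; ring.
have XE : X n.+1 = X n + d' by rewrite /d'; ring.
have dd' : `|d - d'| = dxn by rewrite /d /d' increment_diff.
have ntau : n%:R * tau <= T by have /andP[] := tmT nN'.
pose kbt := (kb (xi n.+1) - kb (xi n)) - (kb (X n.+1) - kb (X n)).
have kbt_le : `|kbt| <= H * dxn + H * (H * tau) * Y n.
  rewrite /kbt xiE XE; apply: le_trans (shifted_difference_bound H0 kb_lip kb_lip2 _ _ _ _) _ => //.
  rewrite dd' lerD2l; apply: ler_pM => //; first exact: mulr_ge0.
    by rewrite ler_wpM2l.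
  exact: normr_le_sum_increments.
pose A1 := (Phi n.+1 n.+1 - Phi n.+1 n) * (v (delta n) * ks n * tau).
have A1_le : `|A1| <= H * (tau + H * tau) * (H * H * tau).
  rewrite /A1 normrM; apply: ler_pM => //; last exact: forcing_bound.
  rewrite /Phi subrr -/d; apply: le_trans (ph_lip _ _ _ _) _ => //; do ?exact: tmT.
  by rewrite ler_wpM2l// tmS (ger0_norm tau0) lerD2l sub0r normrN ger0_norm.
pose W m := ((Phi n.+1 m.+1 - Phi n m.+1) - (Phi n.+1 m - Phi n m)) * (v (delta m) * ks m * tau).
have W_le : `|\sum_(0 <= m < n) W m| <= n%:R * (H * (H * tau) * (tau + H * tau) * (H * H * tau)).
  apply: norm_sum_le_const => m mn; have mN : (m < N)%N := ltn_trans mn nN.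
  rewrite /W normrM; apply: ler_pM => //; last exact/forcing_bound/ltnW.
  rewrite /Phi xiE !(addrAC (xi n) d).
  have /andP[i0 iH] := xi_incr mN.
  apply: le_trans (ph_lip2 (tmT mN) (tmT (ltnW mN)) (xi_mono mn nN')
    (xi_mono (ltnW mn) nN') d0) _.
  apply: ler_pM; [exact: mulr_ge0|by rewrite addr_ge0|by rewrite ler_wpM2l|].
  rewrite tmS (ger0_norm tau0) lerD2l.
  have -> : xi n - xi m.+1 - (xi n - xi m) = - (xi m.+1 - xi m) by ring.
  by rewrite normrN ger0_norm.
pose PsiX m := ph (tm m.+1) (X n.+1 - X m.+1) - ph (tm m.+1) (X n - X m.+1).
pose Q m := (Phi n.+1 m.+1 - Phi n m.+1) * g m - PsiX m * G m.
have Q_le m : (m < n)%N ->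
    `|Q m| <= H * (H * tau) * a m + (H * dxn + H * (H * tau) * (2 * Y n)) * (H * tau).
  move=> mn; have mN : (m < N)%N := ltn_trans mn nN.
  have -> : Q m = (Phi n.+1 m.+1 - Phi n m.+1) * (g m - G m)
     + ((Phi n.+1 m.+1 - Phi n m.+1) - PsiX m) * G m by rewrite /Q; ring.
  apply: le_trans (ler_normD _ _) _; rewrite !normrM; apply: lerD.
    rewrite ler_wpM2r// /Phi xiE (addrAC (xi n) d).
    have xm := xi_mono mn nN'.
    apply: le_trans (ph_lip (tmT mN) (tmT mN) (addr_ge0 xm d0) xm) _.
    rewrite ler_wpM2l// subrr normr0 add0r addrAC subrr add0r ger0_norm//.
  apply: ler_pM => //; last exact: G_bound.
  rewrite /Phi /PsiX xiE XE (addrAC (xi n) d) (addrAC (X n) d').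
  have tmm := tmT mN.
  have l1 y z : 0 <= y -> 0 <= z -> `|ph (tm m.+1) y - ph (tm m.+1) z| <= H * `|y - z|.
    by move=> y0 z0; apply: le_trans (ph_lip tmm tmm y0 z0) _; rewrite subrr normr0 add0r.
  have l2 y z c : 0 <= y -> 0 <= z -> 0 <= c -> `|(ph (tm m.+1) (y + c) - ph (tm m.+1) y)
      - (ph (tm m.+1) (z + c) - ph (tm m.+1) z)| <= H * c * `|y - z|.
    by move=> y0 z0 c0; apply: le_trans (ph_lip2 tmm tmm y0 z0 c0) _; rewrite subrr normr0 add0r.
  apply: le_trans (shifted_difference_bound H0 l1 l2 (xi_mono mn nN') (X_mono mn nN') d0 d'0) _.
  rewrite dd' lerD2l; apply: ler_pM => //; first exact: mulr_ge0.
    by rewrite ler_wpM2l.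
  have -> : xi n - xi m.+1 - (X n - X m.+1) = x n - x m.+1 by rewrite /x; ring.
  apply: le_trans (ler_normB _ _) _; rewrite mulr_natl mulr2n; apply: lerD.
    exact: normr_le_sum_increments.
  by apply: le_trans (normr_le_sum_increments _ x0) _; exact: Y_mono.
have Qs_le : `|\sum_(0 <= m < n) Q m| <= H * (H * tau) * S n
    + n%:R * ((H * dxn + H * (H * tau) * (2 * Y n)) * (H * tau)).
  apply: le_trans (ler_norm_sum _ _ _) _.
  apply: (@le_trans _ _ (\sum_(0 <= m < n) (H * (H * tau) * a m +
     (H * dxn + H * (H * tau) * (2 * Y n)) * (H * tau)))).
    by apply: ler_sum_nat => m /andP[_]; exact: Q_le.
  by rewrite big_split/= -mulr_sumr sumr_const_nat subn0 -[X in _ + X <= _]mulr_natl.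
have ex := exact_step nN; rewrite -/(PsiX _) in ex.
set E := K n.+1 - _ - _ - _ - _ in ex.
have key : ph (tm n.+1) 0 * (g n - G n) =
   (ks n.+1 - K n.+1) - (ks n - K n) + rho n - kbt + A1
   - \sum_(0 <= m < n) Q m + \sum_(0 <= m < n) W m + E.
  have -> : ks n.+1 - K n.+1 - (ks n - K n) = (ks n.+1 - ks n) - (K n.+1 - K n) by ring.
  rewrite (numeric_step nN) /kbt /A1 /E /Q sumrB /W; ring.
have tot : `|ph (tm n.+1) 0 * (g n - G n)| <= tau ^+ 2 + tau ^+ 2 + tau ^+ 2
   + (H * dxn + H * (H * tau) * Y n) + H * (tau + H * tau) * (H * H * tau)
   + (H * (H * tau) * S n + n%:R * ((H * dxn + H * (H * tau) * (2 * Y n)) * (H * tau)))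
   + n%:R * (H * (H * tau) * (tau + H * tau) * (H * H * tau)) + H * tau ^+ 2.
  rewrite key; apply: le_trans (ler_normD _ _) (lerD _ ex).
  apply: le_trans (ler_normD _ _) (lerD _ W_le).
  apply: le_trans (ler_normB _ _) (lerD _ Qs_le).
  apply: le_trans (ler_normD _ _) (lerD _ A1_le).
  apply: le_trans (ler_normB _ _) (lerD _ kbt_le).
  apply: le_trans (ler_normD _ _) (lerD _ (rho_bound nN')).
  by apply: le_trans (ler_normB _ _) _; apply: lerD; apply: noise.
have a_le : a n <= H * `|ph (tm n.+1) 0 * (g n - G n)|.
  have p1 := ph_pos (tmT nN).
  rewrite normrM -/(a n) mulrA -[leLHS]mul1r; apply: ler_wpM2r; first exact: normr_ge0.
  by apply: le_trans p1 _; rewrite ler_wpM2l// ler_norm.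
apply: le_trans a_le _; rewrite -[leRHS]mulrA ler_wpM2l//; apply: le_trans tot _.
have dxn0 : 0 <= dxn by exact: normr_ge0.
clearbody dxn; move: ntau dxn0 Yn0 Sn0; move: (Y n) (S n) (n%:R : R) => y s q qt dn0 y0 s0.
have t1 : q * ((H * dxn + H * (H * tau) * (2 * y)) * (H * tau)) <=
    T * ((H * dxn + H * (H * tau) * (2 * y)) * H).
  rewrite (_ : q * _ = q * tau * ((H * dxn + H * (H * tau) * (2 * y)) * H)); last by ring.
  by apply: ler_wpM2r => //; rewrite mulr_ge0// addr_ge0// !mulr_ge0.
have t2 : q * (H * (H * tau) * (tau + H * tau) * (H * H * tau)) <=
    T * (H * H * (tau + H * tau) * (H * H * tau)).
  rewrite (_ : q * _ = q * tau * (H * H * (tau + H * tau) * (H * H * tau))); last by ring.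
  by apply: ler_wpM2r => //; rewrite !mulr_ge0// addr_ge0// mulr_ge0.
apply: le_trans (lerD (lerD (lerD (lexx _) (lerD (lexx _) t1)) t2) (lexx _)) _.
set c := _ + T * H * (H + 2 * H ^+ 2).
rewrite -subr_ge0.
have -> : c * (tau ^+ 2 + dxn + tau * y + tau * s) -
  (tau ^+ 2 + tau ^+ 2 + tau ^+ 2 + (H * dxn + H * (H * tau) * y) + H * (tau + H * tau) * (H * H * tau) +
   (H * (H * tau) * s + T * ((H * dxn + H * (H * tau) * (2 * y)) * H)) +
   T * (H * H * (tau + H * tau) * (H * H * tau)) + H * tau ^+ 2) =
  (H + 2 * H ^+ 2 + T * H * (H + 2 * H ^+ 2)) * tau ^+ 2
  + (3 + H + 2 * H ^+ 2 + H ^+ 3 * (1 + H) + T * H ^+ 4 * (1 + H) + 2 * T * H ^+ 3) * dxn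
  + (3 + 2 * H + H ^+ 2 + H ^+ 3 * (1 + H) + T * H ^+ 4 * (1 + H) + T * H ^+ 2) * (tau * y)
  + (3 + 2 * H + H ^+ 2 + H ^+ 3 * (1 + H) + T * H ^+ 4 * (1 + H) + T * H * (H + 2 * H ^+ 2)) * (tau * s).
  by rewrite /c; ring.
by rewrite ?(addr_ge0, mulr_ge0, exprn_ge0, ler0n, ler01).
Qed.

Definition scheme_constant : R :=
  let c := (H + H * H + H * T) + H * (3 + 2 * H + 2 * H ^+ 2 + H ^+ 3 * (1 + H)
     + T * H ^+ 4 * (1 + H) + T * H * (H + 2 * H ^+ 2)) in
  (2 * c + c * c) * expR ((4 * c + 2 * c * c + 2 * c) * T).

Lemma scheme_error n : (n < N)%N ->
  `|delta n.+1 - delta n + v (delta n) * ks n * tau - G n| <= scheme_constant * tau ^+ 2.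
Proof.
move=> nN; have T0 : 0 <= T by exact: le_trans tauT.
rewrite /scheme_constant.
set c1 := H + H * H + H * T; set c2 := H * (_ + _).
have c10 : 0 <= c1 by rewrite /c1 !addr_ge0// mulr_ge0.
have c20 : 0 <= c2 by rewrite /c2 ?(addr_ge0, mulr_ge0, exprn_ge0, ler0n, ler01).
have Hc : H <= c1 by rewrite /c1 -addrA lerDl addr_ge0// mulr_ge0.
apply: (@error_recursion_bound _ a x e (c1 + c2) tau T N) => //.
- exact: addr_ge0.
- by rewrite NT.
- by rewrite /e delta0 subrr.
- by move=> i; exact: normr_ge0.
- move=> i iN; apply: le_trans (x_step iN) _.
  rewrite -!mulrA ler_wpM2r// ?mulr_ge0// ?addr_ge0//.
  by apply: le_trans Hc _; rewrite lerDl.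
- move=> i iN; apply: le_trans (e_step iN) _.
  rewrite lerD2l -!mulrA ler_wpM2r// ?mulr_ge0// ?addr_ge0//.
  by rewrite lerDl.
move=> i iN; apply: le_trans (a_step iN) _.
apply: ler_wpM2r; last by rewrite lerDr.
rewrite !addr_ge0 ?sqr_ge0 ?normr_ge0// mulr_ge0//; apply: sumr_ge0 => m _; exact: normr_ge0.
Qed.

End SchemeError.

(** * Preliminary reductions *)

Section Preliminaries.
Context {R : realType}.

Lemma maxr_lipschitz (a b c : R) : `|Num.max a c - Num.max b c| <= `|a - b|.
Proof.
have := ler_norm (a - b); have := ler_norm (b - a); rewrite (distrC b a).
rewrite /Num.max; move: `|a - b| => r h1 h2.
by case: (ltP a c) => ac; case: (ltP b c) => bc; rewrite ler_norml; lra.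
Qed.

Lemma minr_lipschitz (a b c : R) : `|Num.min a c - Num.min b c| <= `|a - b|.
Proof.
have := ler_norm (a - b); have := ler_norm (b - a); rewrite (distrC b a).
rewrite /Num.min; move: `|a - b| => r h1 h2.
by case: (ltP a c) => ac; case: (ltP b c) => bc; rewrite ler_norml; lra.
Qed.

(** Composed with [clamp T] in time and [pos] in space, a Lipschitz function on the
    strip becomes one on the whole plane, with the same constant. *)
Definition clamp (T t : R) : R := Num.max (Num.min t T) 0.
Definition pos (x : R) : R := Num.max x 0.

Lemma clamp_lipschitz T s t : `|clamp T s - clamp T t| <= `|s - t|.
Proof. exact: le_trans (maxr_lipschitz _ _ _) (minr_lipschitz _ _ _). Qed.

Lemma pos_lipschitz x y : `|pos x - pos y| <= `|x - y|.
Proof. exact: maxr_lipschitz. Qed.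

Lemma clamp_itv T t : 0 <= T -> 0 <= clamp T t <= T.
Proof. by move=> T0; rewrite /clamp le_max lexx orbT ge_max T0 ge_min lexx orbT. Qed.

Lemma pos_ge0 x : 0 <= pos x. Proof. by rewrite /pos le_max lexx orbT. Qed.

Lemma clampE T t : 0 <= t <= T -> clamp T t = t.
Proof. by move=> /andP[t0 tT]; rewrite /clamp (min_idPl tT) (max_idPl t0). Qed.

Lemma posE x : 0 <= x -> pos x = x. Proof. by move=> x0; rewrite /pos (max_idPl x0). Qed.

Lemma velocity_data (V : R -> R) (L : R) : 0 < L ->
  [bounded V s | s in halfline] -> [lipschitz V s | s in halfline] ->
  (forall s, 0 <= s -> 0 <= V s) ->
  exists A l : R, [/\ 0 <= A, 0 <= l, forall s, 0 <= Vplus V (s / L) <= A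
    & forall s s', `|Vplus V (s / L) - Vplus V (s' / L)| <= l * `|s - s'|].
Proof.
move=> L0 [A [_ hA]] [l [_ hl]] V0.
have hp s : halfline (pos s) by rewrite /halfline /= in_itv/= andbT pos_ge0.
exists (`|A| + 1), ((`|l| + 1) / L); split; rewrite ?addr_ge0// ?divr_ge0 ?addr_ge0 ?(ltW L0)//.
  move=> s; rewrite V0 ?pos_ge0//=; apply: le_trans (ler_norm _) _.
  have A1 : A < `|A| + 1 by rewrite (le_lt_trans (ler_norm _))// ltrDl.
  exact: (hA _ A1 (pos (s / L)) (hp _)).
move=> s s'; have l1 : l < `|l| + 1 by rewrite (le_lt_trans (ler_norm _))// ltrDl.
have := hl _ l1 (pos (s / L), pos (s' / L)) (conj (hp _) (hp _)).
rewrite /= => /le_trans; apply; rewrite -mulrA ler_wpM2l ?addr_ge0//.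
apply: le_trans (pos_lipschitz _ _) _.
by rewrite -mulrBl normrM mulrC (ger0_norm (_ : 0 <= L^-1)) ?invr_ge0 ?(ltW L0).
Qed.

Lemma strip_lipschitz (T : R) (k : R -> R -> R) :
  [lipschitz k z.1 z.2 | z in (strip T : set (R * R))] ->
  exists2 K, 0 <= K & forall s t x y, 0 <= s <= T -> 0 <= t <= T -> 0 <= x -> 0 <= y ->
    `|k s x - k t y| <= K * (`|s - t| + `|x - y|).
Proof.
move=> [l [_ hl]]; exists (`|l| + 1); first by rewrite addr_ge0.
move=> s t x y sT tT x0 y0.
have l1 : l < `|l| + 1 by rewrite (le_lt_trans (ler_norm _))// ltrDl.
have S r z : 0 <= r <= T -> 0 <= z -> strip T (r, z).
  by move=> rT z0; rewrite /strip /= !in_itv/= andbT.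
have := hl _ l1 ((s, x), (t, y)) (conj (S _ _ sT x0) (S _ _ tT y0)).
rewrite /= => /le_trans; apply; rewrite ler_wpM2l ?addr_ge0//.
by rewrite prod_normE/= ge_max lerDl lerDr !normr_ge0.
Qed.

(** The essential bound on [f] becomes a pointwise one after truncation, which changes
    [f] on a negligible set only. *)
Lemma truncated_inflow (T : R) (f : R -> R) (F := fine (Linfty_norm leb `[0, T] f)) :
  Linfty leb `[0, T] f ->
  exists fc : R -> R, [/\ 0 <= F, measurable_fun [set: R] fc, forall s, `|fc s| <= F,
    {ae leb, forall t, 0 <= t <= T -> fc t = f t}
    & forall a b, 0 <= a -> b <= T ->
        segint a b fc = \int[leb]_(t in `[a, b]) f t].
Proof.
move=> [mf fin]; have F0 : 0 <= F by rewrite fine_ge0// Lnorm_ge0.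
pose fc (s : R) := Num.max (Num.min ((f \_ `[0, T]) s) F) (- F).
have mfc : measurable_fun [set: R] fc.
  apply: (@measurable_maxr _ _ _ _ (fun s => Num.min ((f \_ `[0, T]) s) F) (fun=> - F)) => //.
  apply: (@measurable_minr _ _ _ _ (f \_ `[0, T]) (fun=> F)) => //.
  by apply/(measurable_restrictT f (measurable_itv _)).
have fcE : {ae leb, forall t, 0 <= t <= T -> fc t = f t}.
  have := Linfty_norm_ae fin; rewrite -/F.
  apply: (@filterS _ _ (ae_filter_ringOfSetsType leb)) => t ft tT.
  have tI : `[0, T]%classic t by rewrite /= in_itv.
  have := ft tI; rewrite ler_norml => /andP[f1 f2].
  by rewrite /fc patchE mem_set// (min_idPl f2) (max_idPl f1).
exists fc; split => //.
  move=> s; rewrite ler_norml /fc le_max lexx orbT ge_max ge_min lexx orbT/=.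
  by rewrite -subr_ge0 opprK addr_ge0.
move=> a b a0 bT; rewrite segintE; congr fine.
apply: ae_eq_integral => //.
- by apply/measurable_EFinP; exact: measurable_funTS.
- apply/measurable_EFinP; apply: measurable_funS mf => //.
  by apply: subset_itv; rewrite bnd_simp.
move: fcE; apply: (@filterS _ _ (ae_filter_ringOfSetsType leb)) => t ft.
rewrite /= in_itv/= => /andP[at' tb]; rewrite ft//.
by rewrite (le_trans a0 at') (le_trans tb bT).
Qed.

Lemma derivable_quotient_cvg (g : R -> R) x : derivable g x 1 ->
  (g (x + n.+1%:R^-1) - g x) * n.+1%:R @[n --> \oo] --> derive1 g x.
Proof.
move=> dg; rewrite derive1E.
have /cvgrPdist_lt h := dg : (fun h => h^-1 *: (g (h *: 1 + x) - g x)) @ 0^' --> 'D_1 g x.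
apply/cvgrPdist_lt => e e0; have /nbhs_ballP[d /= d0 dP] := h e e0.
have /cvgrPdist_lt /(_ d d0) := @invSn_cvg0 R; apply: filterS => n nd.
have := dP n.+1%:R^-1 nd; rewrite invr_eq0 pnatr_eq0 => /(_ isT).
by rewrite invrK /GRing.scale /= mulr1 (addrC _ x) mulrC.
Qed.

(** The infimum is attained, at a point where [phi] is positive. *)
Lemma phi_min_pos (T : R) (phi : R -> R -> R) (t : R) : 0 < T ->
  {within strip T, continuous (fun z : R * R => phi z.1 z.2)} ->
  (forall t, 0 <= t <= T -> 0 < phi t 0) -> 0 <= t <= T ->
  0 <= (phi_min0 T phi)^-1 /\ 1 <= (phi_min0 T phi)^-1 * phi t 0.
Proof.
move=> T0 cphi phi0 tT.
have c0 : {within `[0, T], continuous (phi^~ 0)}.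
  apply: within_continuous_ballP => s; rewrite /= in_itv/= => sT e e0.
  have hz : strip T (s, 0) by rewrite /strip /= !in_itv/= sT lexx.
  have [d d0 dP] := within_continuous_ball cphi hz e0; exists d => // r.
  rewrite /= in_itv/= => rT sr; apply: (dP (r, 0)); first by rewrite /strip /= !in_itv/= rT lexx.
  by split => //=; exact: ballxx.
have [c cT cm] := EVT_min (ltW T0) c0.
rewrite in_itv/= in cT; have pc := phi0 c cT.
have lb : lbound [set phi t 0 | t in `[0, T]] (phi c 0).
  by move=> _ [s /= sT <-]; exact: cm.
have mc : phi c 0 <= phi_min0 T phi.
  by apply: lb_le_inf => //; exists (phi t 0), t => //=; rewrite in_itv.
have m0 : 0 < phi_min0 T phi by exact: lt_le_trans mc.
split; first by rewrite invr_ge0 ltW.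
rewrite mulrC ler_pdivlMr// mul1r; apply: ge_inf; first by exists (phi c 0).
by exists t => //=; rewrite in_itv.
Qed.

End Preliminaries.

(** * Identities satisfied by the solution *)

Section Solution.
Context {R : realType}.
Variables (T L K M A l F : R) (V f fc kbar : R -> R) (phi k : R -> R -> R).
Hypotheses (T0 : 0 < T) (L0 : 0 < L) (K0 : 0 <= K) (M0 : 0 <= M) (A0 : 0 <= A)
  (l0 : 0 <= l) (F0 : 0 <= F).
Let v s := Vplus V (s / L).
Hypothesis v_bound : forall s, 0 <= v s <= A.
Hypothesis v_lip : forall s s', `|v s - v s'| <= l * `|s - s'|.
Hypothesis k_lip : forall s t x y, 0 <= s <= T -> 0 <= t <= T -> 0 <= x -> 0 <= y ->
  `|k s x - k t y| <= K * (`|s - t| + `|x - y|).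
Hypothesis phi_bound : forall t x, 0 <= t <= T -> 0 <= x -> `|phi t x| <= M.
Hypothesis phi_lip : forall s t x y, 0 <= s <= T -> 0 <= t <= T -> 0 <= x -> 0 <= y ->
  `|phi s x - phi t y| <= M * (`|s - t| + `|x - y|).
Hypothesis phi_supp : forall t x, 0 <= t <= T -> L < x -> phi t x = 0.
Hypothesis phi_mass : forall t, 0 <= t <= T ->
  (\int[leb]_(x in halfline) (phi t x)%:E = 1)%E.
Hypothesis kbar_supp : forall x, L < x -> kbar x = 0.
Hypothesis initial : forall x, 0 <= x -> k 0 x = kbar x.
Hypothesis fc_meas : measurable_fun [set: R] fc.
Hypothesis fc_bound : forall s, `|fc s| <= F.
Hypothesis fcE : {ae leb, forall t, 0 <= t <= T -> fc t = f t}.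
Hypothesis equation : \forall z \ae leb2, strip_int T z ->
  [/\ derivable (fun s => k s z.2) z.1 1, derivable (k z.1) z.2 1
    & dt k z.1 z.2 - Vplus V (nonlocal L k z.1) * dx k z.1 z.2 = f z.1 * phi z.1 z.2].

Let kc t x := k (clamp T t) (pos x).
Let phic t x := phi (clamp T t) (pos x).
Let D t := segint 0 L (kc t).
Let Vh s := v (D s).
Local Notation X := (displacement Vh).

Let cl t : 0 <= clamp T t <= T. Proof. exact/clamp_itv/ltW. Qed.

Let clamp_sum c (c0 : 0 <= c) s t x y :
  c * (`|clamp T s - clamp T t| + `|pos x - pos y|) <= c * (`|s - t| + `|x - y|).
Proof. by rewrite ler_wpM2l// lerD ?clamp_lipschitz// pos_lipschitz. Qed.

Let kc_lip s t x y : `|kc s x - kc t y| <= K * (`|s - t| + `|x - y|).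
Proof.
by apply: le_trans (k_lip (cl s) (cl t) (pos_ge0 x) (pos_ge0 y)) _; exact: clamp_sum.
Qed.

Let phic_lip s t x y : `|phic s x - phic t y| <= M * (`|s - t| + `|x - y|).
Proof.
by apply: le_trans (phi_lip (cl s) (cl t) (pos_ge0 x) (pos_ge0 y)) _; exact: clamp_sum.
Qed.

Let phic_bound t x : `|phic t x| <= M.
Proof. by apply: phi_bound; [exact: cl|exact: pos_ge0]. Qed.

Let lkc t : lbm (kc t).
Proof.
apply/continuous_lbm/(@lipschitz_fun_continuous _ _ K) => x y.
by apply: le_trans (kc_lip _ _ _ _) _; rewrite subrr normr0 add0r.
Qed.

Let lphic t : lbm (phic t).
Proof.
apply/continuous_lbm/(@lipschitz_fun_continuous _ _ M) => x y.
by apply: le_trans (phic_lip _ _ _ _) _; rewrite subrr normr0 add0r.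
Qed.

Let D_lip s t : `|D s - D t| <= K * L * `|s - t|.
Proof.
rewrite /D -segintB// mulrAC -[X in _ * X]subr0; apply: segint_bound; [exact: lbmB|exact: ltW|].
by move=> x _; apply: le_trans (kc_lip _ _ _ _) _; rewrite subrr normr0 addr0.
Qed.

Let Vh_cont : continuous Vh.
Proof.
apply: (@lipschitz_fun_continuous _ _ (l * (K * L))) => s t.
by apply: le_trans (v_lip _ _) _; rewrite -[leRHS]mulrA ler_wpM2l.
Qed.

Let restrict_halfline (g : R -> R) : (forall x, L < x -> g x = 0) ->
  \int[leb]_(x in halfline) g x = \int[leb]_(x in `[0, L]) g x.
Proof.
move=> g0; have -> : `[0, L]%classic = halfline `&` `[0, L]%classic :> set R.
  apply/seteqP; split => x /=; rewrite /halfline /= !in_itv/= ?andbT.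
    by move=> /andP[-> ->].
  by move=> [].
rewrite Rintegral_mkcondr; apply: eq_Rintegral => x; rewrite inE /halfline /= in_itv/= andbT => x0.
rewrite patchE; case: ifPn => //; rewrite notin_setE /= in_itv/= x0/= => /negP.
by rewrite -ltNge; exact: g0.
Qed.

Let nonlocalE t : nonlocal L k (clamp T t) = D t / L.
Proof.
rewrite /nonlocal restrict_halfline; last first.
  move=> x Lx; rewrite /weight indicE memNset ?mulr0//= in_itv/=.
  by move=> /andP[_]; rewrite leNgt Lx.
rewrite -segintE /D mulrC -segintZ//; apply: eq_segint => x xL.
have /andP[x0 _] := xL.
by rewrite /weight indicE mem_set ?mulr1 1?mulrC /kc ?posE//= in_itv.
Qed.

(** Near an interior point the clamped functions agree with the original ones, so
   the partial derivatives are limits of the difference quotients along 1/(n+1). *)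
Let pde : {ae (leb : set R -> \bar R), forall s,
  {ae (leb : set R -> \bar R), forall y, 0 < s < T -> 0 < y ->
    (kc (s + n.+1%:R^-1) y - kc s y) * n.+1%:R
      - Vh s * ((kc s (y + n.+1%:R^-1) - kc s y) * n.+1%:R) @[n --> \oo] --> fc s * phic s y}}.
Proof.
have := ae_sections equation; move: fcE.
apply: (@filterS2 _ _ (ae_filter_ringOfSetsType leb)) => s fs.
apply: (@filterS _ _ (ae_filter_ringOfSetsType leb)) => y eqn sT y0.
have /andP[s0 sT'] := sT.
have sTT : 0 <= s <= T by rewrite (ltW s0) ltW.
have [|d1 d2 /= eq] := eqn; first by rewrite /strip_int /= !in_itv/= sT y0.
rewrite /= in d1 d2.
have -> : fc s * phic s y = dt k s y - Vh s * dx k s y.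
  by rewrite fs// /phic clampE// posE ?(ltW y0)// -eq /Vh /v -nonlocalE clampE.
have c1 := derivable_quotient_cvg d1; have c2 := derivable_quotient_cvg d2.
have c3 : (k (s + n.+1%:R^-1) y - k s y) * n.+1%:R
      - Vh s * ((k s (y + n.+1%:R^-1) - k s y) * n.+1%:R) @[n --> \oo] -->
   dt k s y - Vh s * dx k s y.
  by apply: cvgB c1 _; apply: cvgM c2; exact: cvg_cst.
apply: cvg_trans c3; apply: near_eq_cvg.
have Ts : 0 < T - s by rewrite subr_gt0.
have /cvgrPdist_lt /(_ _ Ts) := @invSn_cvg0 R; apply: filterS => n.
rewrite sub0r normrN ger0_norm// => nT.
rewrite /kc !clampE// ?posE//; do ?[exact: ltW]; first by rewrite addr_ge0// ltW.
by rewrite addr_ge0 ?(ltW s0)//= -lerBrDl ltW.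
Qed.

Let Vh_bound s : 0 <= Vh s <= A. Proof. exact: v_bound. Qed.

(** The support condition leaves the value at [L] itself to continuity. *)
Let zero_at_edge (g : R -> R) c x : (forall x y, 0 <= x -> 0 <= y -> `|g x - g y| <= c * `|x - y|) ->
  (forall x, L < x -> g x = 0) -> L <= x -> g x = 0.
Proof.
move=> gc g0; rewrite le_eqVlt => /predU1P[<-|]; last exact: g0.
apply/eqP; rewrite -normr_le0; apply: (@arch_le0 _ _ c) => n.
have h0 : 0 < n.+1%:R^-1 :> R by rewrite invr_gt0.
have := gc L (L + n.+1%:R^-1) (ltW L0) (addr_ge0 (ltW L0) (ltW h0)).
rewrite (g0 (L + _)) ?ltrDl// subr0 opprD addrA subrr sub0r normrN (ger0_norm (ltW h0)).
by rewrite ler_pdivlMr.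
Qed.

Let phic_edge t x : L <= x -> phic t x = 0.
Proof.
move=> Lx; rewrite /phic posE; last exact: le_trans (ltW L0) Lx.
apply: (@zero_at_edge (phi (clamp T t)) M) => // [y z y0 z0|y Ly].
  by apply: le_trans (phi_lip (cl t) (cl t) y0 z0) _; rewrite subrr normr0 add0r.
by apply: phi_supp => //; exact: cl.
Qed.

Let kbar_lip x y : 0 <= x -> 0 <= y -> `|kbar x - kbar y| <= K * `|x - y|.
Proof.
move=> x0 y0; rewrite -!initial//; have T00 : 0 <= (0 : R) <= T by rewrite lexx ltW.
by apply: le_trans (k_lip T00 T00 x0 y0) _; rewrite subrr normr0 add0r.
Qed.

Let kbar_edge x : L <= x -> kbar x = 0.
Proof. by apply: (@zero_at_edge kbar K) => // y z; exact: kbar_lip. Qed.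

Let X_incr s t : 0 <= s -> s <= t -> 0 <= X t - X s.
Proof.
by move=> s0 st; have /andP[] := displacement_increment Vh_cont Vh_bound s0 st.
Qed.

Let X_ge0 t : 0 <= t -> 0 <= X t.
Proof.
move=> t0; have := X_incr (lexx 0) t0.
by rewrite {2}/displacement segintxx subr0.
Qed.

Let kc0 x : 0 <= x -> kc 0 x = kbar x.
Proof. by move=> x0; rewrite /kc clampE ?posE ?initial// lexx ltW. Qed.

Let representation b t : 0 <= t <= T -> X t <= b ->
  kc t (b - X t) = kbar b + segint 0 t (fun s => fc s * phic s (b - X s)).
Proof.
move=> /andP[t0 tT] Xb.
rewrite (characteristic_formula K0 M0 A0 kc_lip phic_bound phic_lip Vh_cont Vh_bound
  fc_meas fc_bound pde t0 tT Xb) kc0//.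
exact: le_trans (X_ge0 t0) Xb.
Qed.

Let kc_edge t : 0 <= t <= T -> kc t L = 0.
Proof.
move=> tT; have /andP[t0 _] := tT.
have XL : X t <= L + X t by rewrite lerDr ltW.
have := representation tT XL; rewrite addrK => ->.
rewrite kbar_edge ?lerDl ?X_ge0// add0r.
rewrite -[RHS](mul0r (t - 0)) -segint_cst//; apply: eq_segint => s /andP[s0 st].
by rewrite phic_edge ?mulr0// -addrA lerDl X_incr.
Qed.

Let phic_mass t : segint 0 L (phic t) = 1.
Proof.
have -> : segint 0 L (phic t) = \int[leb]_(x in halfline) phi (clamp T t) x.
  rewrite restrict_halfline; last by move=> x; apply: phi_supp; exact: cl.
  by rewrite -segintE; apply: eq_segint => x /andP[x0 _]; rewrite /phic posE.
by rewrite /Rintegral phi_mass ?cl.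
Qed.

(** No mass crosses [L]: a characteristic ending there at time [t] stays in [L, oo[,
    where [kbar] and [phi] vanish.  Hence the balance over [0, L] has a flux through 0
    only, and an inflow equal to [fc] since [phi t] has integral 1. *)
Lemma solution_identities : exists D : R -> R,
  [/\ D 0 = total_mass kbar, continuous D,
    forall s t, 0 <= s -> s <= t -> t <= T ->
      D t - D s = segint s t (fun r => fc r - v (D r) * k (clamp T r) 0)
    & forall t, 0 <= t <= T ->
      k t 0 = kbar (displacement (fun s => v (D s)) t)
        + segint 0 t (fun s => fc s * phi (clamp T s)
            (pos (displacement (fun s => v (D s)) t - displacement (fun s => v (D s)) s)))].
Proof.
exists D; split.
- rewrite /total_mass restrict_halfline// -segintE; apply: eq_segint => x /andP[x0 _].
  exact: kc0.
- exact: (lipschitz_fun_continuous D_lip).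
- move=> s t s0 st tT.
  have := mass_balance K0 M0 kc_lip phic_lip Vh_cont Vh_bound fc_meas fc_bound pde
    (ltW L0) s0 st tT; rewrite -/(D t) -/(D s) => ->.
  apply: eq_segint => r /andP[sr rt].
  rewrite kc_edge; last by rewrite (le_trans s0 sr) (le_trans rt tT).
  by rewrite phic_mass /kc posE// /Vh; ring.
move=> t tT; have := representation tT (lexx _).
by rewrite subrr /kc posE// clampE.
Qed.

End Solution.

(** * One-step expansions of the exact solution *)

Section ExactSteps.
Context {R : realType}.

Lemma segint_sum (g : R -> R) (t : nat -> R) n : lbm g -> (forall m, t m <= t m.+1) ->
  segint (t 0%N) (t n) g = \sum_(0 <= m < n) segint (t m) (t m.+1) g.
Proof.
move=> lg tS; elim: n => [|n IH]; first by rewrite big_geq// segintxx.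
rewrite big_nat_recr//= -IH -segint_split//.
have : forall i, (i <= n)%N -> t 0%N <= t i.
  by elim=> // i IHi /ltnW /IHi /le_trans; apply.
exact.
Qed.

Variables (T A l F M B : R) (v fc kbar trace D : R -> R) (phi : R -> R -> R).
Hypotheses (T0 : 0 < T) (A0 : 0 <= A) (l0 : 0 <= l) (F0 : 0 <= F) (M0 : 0 <= M) (B0 : 0 <= B).
Hypothesis v_bound : forall s, 0 <= v s <= A.
Hypothesis v_lip : forall s s', `|v s - v s'| <= l * `|s - s'|.
Hypothesis fc_meas : measurable_fun [set: R] fc.
Hypothesis fc_bound : forall s, `|fc s| <= F.
Hypothesis kbar_bound : forall x, 0 <= x -> `|kbar x| <= B.
Hypothesis kbar_lip : forall x y, 0 <= x -> 0 <= y -> `|kbar x - kbar y| <= B * `|x - y|.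
Hypothesis phi_bound : forall t x, 0 <= t <= T -> 0 <= x -> `|phi t x| <= M.
Hypothesis phi_lip : forall s t x y, 0 <= s <= T -> 0 <= t <= T -> 0 <= x -> 0 <= y ->
  `|phi s x - phi t y| <= M * (`|s - t| + `|x - y|).
Hypothesis phi_lip2 : forall s t x y d,
  0 <= s <= T -> 0 <= t <= T -> 0 <= x -> 0 <= y -> 0 <= d ->
  `|(phi s (x + d) - phi s x) - (phi t (y + d) - phi t y)| <= M * d * (`|s - t| + `|x - y|).
Hypotheses (trace_cont : continuous trace) (D_cont : continuous D).
Hypothesis D_id : forall s t, 0 <= s -> s <= t -> t <= T ->
  D t - D s = segint s t (fun r => fc r - v (D r) * trace r).
Let Vh s := v (D s).
Local Notation X := (displacement Vh).
Hypothesis trace_id : forall t, 0 <= t <= T ->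
  trace t = kbar (X t) + segint 0 t (fun s => fc s * phi (clamp T s) (pos (X t - X s))).

Let cl t : 0 <= clamp T t <= T. Proof. exact/clamp_itv/ltW. Qed.

Let v_cont : continuous v. Proof. exact: lipschitz_fun_continuous v_lip. Qed.
Let Vh_cont : continuous Vh.
Proof. by move=> s; apply: continuous_comp; [exact: D_cont|exact: v_cont]. Qed.
Let Vh_bound s : 0 <= Vh s <= A. Proof. exact: v_bound. Qed.
Let Vh_norm s : `|Vh s| <= A. Proof. by have /andP[? ?] := Vh_bound s; rewrite ger0_norm. Qed.
Let lVh : lbm Vh. Proof. exact: continuous_lbm. Qed.
Let ltrace : lbm trace. Proof. exact: continuous_lbm. Qed.
Let lfc : lbm fc. Proof. by split => // a b; exists F. Qed.

Lemma displacement_incr s t : 0 <= s -> s <= t -> 0 <= X t - X s <= A * (t - s).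
Proof. exact: displacement_increment. Qed.

Let X0 : X 0 = 0. Proof. by rewrite /displacement segintxx. Qed.

Lemma displacement_ge0 t : 0 <= t -> 0 <= X t.
Proof. by move=> t0; have /andP[+ _] := displacement_incr (lexx 0) t0; rewrite X0 subr0. Qed.

Let q x s := phi (clamp T s) (pos (x - X s)).

Let X_lip s t : `|X s - X t| <= A * `|s - t|.
Proof. exact: segint_lipschitz. Qed.

Let q_lip x s t : `|q x s - q x t| <= M * (1 + A) * `|s - t|.
Proof.
apply: le_trans (phi_lip (cl s) (cl t) (pos_ge0 _) (pos_ge0 _)) _.
rewrite -[leRHS]mulrA ler_wpM2l// mulrDl mul1r; apply: lerD; first exact: clamp_lipschitz.
apply: le_trans (pos_lipschitz _ _) _.
have -> : x - X s - (x - X t) = X t - X s by ring.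
by rewrite distrC.
Qed.

Let lfq x : lbm (fun s => fc s * q x s).
Proof. by apply: lbmM => //; apply/continuous_lbm/(@lipschitz_fun_continuous _ _ (M * (1 + A))). Qed.

Let q_bound x s : `|q x s| <= M.
Proof. by apply: phi_bound; [exact: cl|exact: pos_ge0]. Qed.

Let q_x x y s : `|q x s - q y s| <= M * `|x - y|.
Proof.
apply: le_trans (phi_lip (cl s) (cl s) (pos_ge0 _) (pos_ge0 _)) _.
rewrite subrr normr0 add0r ler_wpM2l//; apply: le_trans (pos_lipschitz _ _) _.
by have -> : x - X s - (y - X s) = x - y by ring.
Qed.

Let lfqB x y : lbm (fun s => fc s * (q x s - q y s)).
Proof.
by apply: lbmM => //; apply: lbmB; apply/continuous_lbm/(@lipschitz_fun_continuous _ _ (M * (1 + A))).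
Qed.

(** A bound and a Lipschitz constant in time for the trace of the density at 0, and a
    Lipschitz constant for the mass.  All of them depend on the data only, and not on
    the Lipschitz constant of the solution. *)
Definition density_bound : R := B + T * F * M.
Definition density_lip : R := B * A + F * M + T * F * M * A.
Definition mass_lip : R := F + A * density_bound.
Local Notation KM := density_bound.

Lemma trace_bound t : 0 <= t <= T -> `|trace t| <= KM.
Proof.
move=> /andP[t0 tT]; rewrite trace_id ?t0//; apply: le_trans (ler_normD _ _) _.
apply: lerD; first by apply: kbar_bound; exact: displacement_ge0.
apply: (@le_trans _ _ (F * M * (t - 0))).
  apply: segint_bound => // [|s _]; first exact: (lfq (X t)).
  by rewrite normrM; apply: ler_pM => //; exact: (q_bound (X t) s).
by rewrite subr0 mulrC mulrA ler_wpM2r// ler_wpM2r.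
Qed.

Let trace_increment s t : 0 <= s -> s <= t -> t <= T ->
  trace t - trace s = (kbar (X t) - kbar (X s)) + segint s t (fun r => fc r * q (X t) r)
    + segint 0 s (fun r => fc r * (q (X t) r - q (X s) r)).
Proof.
move=> s0 st tT; rewrite !trace_id; [|by rewrite s0 (le_trans st)|by rewrite (le_trans s0)].
rewrite -/(q _) (segint_split (lfq (X t)) s0 st).
have -> : segint 0 s (fun r => fc r * (q (X t) r - q (X s) r)) =
   segint 0 s (fun r => fc r * q (X t) r) - segint 0 s (fun r => fc r * q (X s) r).
  rewrite -segintB; [|exact: lfq|exact: lfq].
  by apply: eq_segint => r _; ring.
rewrite /q; ring.
Qed.

Lemma trace_lipschitz s t : 0 <= s -> s <= t -> t <= T -> `|trace t - trace s| <= density_lip * (t - s).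
Proof.
move=> s0 st tT; rewrite trace_increment//; have t0 := le_trans s0 st.
have /andP[dX0 dX] := displacement_incr s0 st.
have ts : 0 <= t - s by rewrite subr_ge0.
rewrite /density_lip mulrDl mulrDl; apply: le_trans (ler_normD _ _) _; apply: lerD.
  apply: le_trans (ler_normD _ _) _; apply: lerD.
    apply: le_trans (kbar_lip (displacement_ge0 t0) (displacement_ge0 s0)) _.
    by rewrite -[leRHS]mulrA ler_wpM2l// ger0_norm.
  apply: segint_bound => // r _.
  by rewrite normrM; apply: ler_pM => //; exact: q_bound.
apply: (@le_trans _ _ (F * (M * (A * (t - s))) * (s - 0))).
  apply: segint_bound => // r _.
  rewrite normrM; apply: ler_pM => //; apply: le_trans (q_x _ _ _) _.
  by rewrite ler_wpM2l// ger0_norm.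
rewrite subr0 mulrC (_ : T * F * M * A * (t - s) = T * (F * (M * (A * (t - s))))); last by ring.
by rewrite ler_wpM2r ?mulr_ge0// (le_trans st).
Qed.

Lemma mass_lipschitz s t : 0 <= s -> s <= t -> t <= T -> `|D t - D s| <= mass_lip * (t - s).
Proof.
move=> s0 st tT; rewrite D_id//; apply: segint_bound => //.
  by apply: lbmB => //; apply: lbmM.
move=> r /andP[sr rt]; apply: le_trans (ler_normB _ _) _; apply: lerD => //.
rewrite normrM; apply: ler_pM => //; first exact: Vh_norm.
by apply: trace_bound; rewrite (le_trans s0 sr) (le_trans rt tT).
Qed.

(** The left rectangle rule is of second order over one step because the velocity is
    Lipschitz in time; the same holds in [mass_step]. *)
Lemma displacement_step s t : 0 <= s -> s <= t -> t <= T ->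
  `|X t - X s - v (D s) * (t - s)| <= l * mass_lip * (t - s) ^+ 2.
Proof.
move=> s0 st tT; rewrite (displacementB Vh_cont s0 st) expr2 mulrA.
apply: segint_near => // r /andP[sr rt]; apply: le_trans (v_lip _ _) _.
rewrite -[leRHS]mulrA ler_wpM2l//; apply: le_trans (mass_lipschitz s0 sr (le_trans rt tT)) _.
rewrite ler_wpM2l ?lerB// /mass_lip addr_ge0// mulr_ge0//.
by rewrite /density_bound addr_ge0// !mulr_ge0// ltW.
Qed.

Let KM0 : 0 <= KM. Proof. by rewrite /density_bound addr_ge0// !mulr_ge0// ltW. Qed.
Let DL0 : 0 <= mass_lip. Proof. by rewrite /mass_lip addr_ge0// mulr_ge0. Qed.
Let KL0 : 0 <= density_lip.
Proof. by rewrite /density_lip !addr_ge0 ?mulr_ge0// ltW. Qed.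

Lemma mass_step s t : 0 <= s -> s <= t -> t <= T ->
  `|D t - D s - (segint s t fc - v (D s) * trace s * (t - s))|
    <= (l * mass_lip * KM + A * density_lip) * (t - s) ^+ 2.
Proof.
move=> s0 st tT; have ts : 0 <= t - s by rewrite subr_ge0.
have lvk : lbm (fun r => v (D r) * trace r) by exact: lbmM.
rewrite D_id// segintB//.
rewrite (_ : _ - _ = - (segint s t (fun r => v (D r) * trace r) - v (D s) * trace s * (t - s))); last by ring.
rewrite normrN expr2 mulrA; apply: segint_near => // r /andP[sr rt].
have rs : 0 <= r - s by rewrite subr_ge0.
have rst : r - s <= t - s by rewrite lerB.
have rT := le_trans rt tT.
have -> : v (D r) * trace r - v (D s) * trace s =
  (v (D r) - v (D s)) * trace r + v (D s) * (trace r - trace s) by ring.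
apply: le_trans (ler_normD _ _) _; rewrite !normrM mulrDl; apply: lerD.
  rewrite (_ : l * mass_lip * KM * (t - s) = l * (mass_lip * (t - s)) * KM); last by ring.
  apply: ler_pM => //; last by apply: trace_bound; rewrite (le_trans s0 sr).
  apply: le_trans (v_lip _ _) _; rewrite ler_wpM2l//.
  by apply: le_trans (mass_lipschitz s0 sr rT) _; rewrite ler_wpM2l.
rewrite -[leRHS]mulrA; apply: ler_pM => //; first exact: Vh_norm.
by apply: le_trans (trace_lipschitz s0 sr rT) _; rewrite ler_wpM2l.
Qed.

(** Freezing the kernel at the right end of each step costs O(tau^2) in the newest
    step.  In an earlier step the kernel is an increment of [phi] over the newest
    displacement, so freezing it is a second difference and costs O(tau^3). *)
Lemma trace_step (tau : R) (N n : nat) (t := fun m : nat => m%:R * tau) :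
  0 <= tau -> N%:R * tau = T -> (n < N)%N ->
  `|trace (t n.+1) - trace (t n) - (kbar (X (t n.+1)) - kbar (X (t n)))
     - phi (t n.+1) 0 * segint (t n) (t n.+1) fc
     - \sum_(0 <= m < n) (phi (t m.+1) (X (t n.+1) - X (t m.+1))
          - phi (t m.+1) (X (t n) - X (t m.+1))) * segint (t m) (t m.+1) fc|
  <= (F * M * (1 + A) + T * F * M * A * (1 + A)) * tau ^+ 2.
Proof.
move=> tau0 NT nN.
have tS m : t m.+1 - t m = tau by rewrite /t -natr1; ring.
have tle m : t m <= t m.+1 by rewrite -subr_ge0 tS.
have tmono i j : (i <= j)%N -> t i <= t j by move=> ij; rewrite /t ler_wpM2r// ler_nat.
have t0 m : 0 <= t m by rewrite /t mulr_ge0.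
have tT m : (m <= N)%N -> t m <= T by move=> mN; rewrite -NT; exact: tmono.
have t00 : t 0%N = 0 by rewrite /t mul0r.
have incr i j : (i <= j)%N -> 0 <= X (t j) - X (t i).
  by move=> ij; have /andP[] := displacement_incr (t0 i) (tmono _ _ ij).
rewrite trace_increment//; last exact: tT.
set d := X (t n.+1) - X (t n).
have d0 : 0 <= d by exact: incr.
have dA : d <= A * tau by have /andP[_] := displacement_incr (t0 n) (tle n); rewrite tS.
rewrite -{1}t00 (segint_sum _ (lfqB _ _))//.
set s1 := segint _ _ _; set s2 := \sum_(_ <= _ < _) segint _ _ _; set s3 := \sum_(_ <= _ < _) _.
rewrite (_ : _ - _ = (s1 - phi (t n.+1) 0 * segint (t n) (t n.+1) fc) + (s2 - s3)); last by ring.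
apply: le_trans (ler_normD _ _) _; rewrite mulrDl; apply: lerD.
  rewrite (_ : F * M * (1 + A) * tau ^+ 2 = F * (M * (1 + A) * tau) * (t n.+1 - t n)); last first.
    by rewrite tS; ring.
  apply: segint_near_weighted => //.
    by apply/continuous_lbm/(@lipschitz_fun_continuous _ _ (M * (1 + A))); exact: q_lip.
  move=> s /andP[sn sn1].
  have -> : phi (t n.+1) 0 = q (X (t n.+1)) (t n.+1).
    by rewrite /q subrr posE// clampE// t0 tT.
  apply: le_trans (q_lip _ _ _) _; rewrite ler_wpM2l ?mulr_ge0 ?addr_ge0//.
  by rewrite distrC ger0_norm ?subr_ge0// -(tS n) lerB.
rewrite /s2 /s3 -sumrB.
apply: (@le_trans _ _ (n%:R * (F * (M * (A * tau) * ((1 + A) * tau)) * tau))).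
  apply: norm_sum_le_const => m mn; have mN : (m < N)%N := ltn_trans mn nN.
  rewrite (_ : F * _ * tau = F * (M * (A * tau) * ((1 + A) * tau)) * (t m.+1 - t m)); last by rewrite tS.
  apply: segint_near_weighted => //.
    by apply: lbmB; apply/continuous_lbm/(@lipschitz_fun_continuous _ _ (M * (1 + A))); exact: q_lip.
  move=> s /andP[sm sm1]; have s0 := le_trans (t0 m) sm.
  have sT : s <= T := le_trans sm1 (tT _ mN).
  have xs : 0 <= X (t n) - X s.
    have /andP[] := displacement_incr s0 (le_trans sm1 (tmono _ _ mn)).
    by [].
  have xm := incr _ _ mn.
  have X1 y : X (t n.+1) - y = X (t n) - y + d by rewrite /d; ring.
  rewrite /q clampE ?s0// !X1 (posE xs) (posE (addr_ge0 xs d0)).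
  apply: le_trans (phi_lip2 _ _ xs xm d0) _; rewrite ?s0 ?t0 ?tT//.
  apply: ler_pM; [exact: mulr_ge0|by rewrite addr_ge0|by rewrite ler_wpM2l|].
  rewrite mulrDl mul1r; have sle : `|s - t m.+1| <= tau.
    by rewrite distrC ger0_norm ?subr_ge0// -(tS m) lerB.
  apply: lerD => //.
  have -> : X (t n) - X s - (X (t n) - X (t m.+1)) = X (t m.+1) - X s by ring.
  by apply: le_trans (X_lip _ _) _; rewrite ler_wpM2l// distrC.
rewrite [leLHS](_ : _ = (n%:R * tau) * (F * M * A * (1 + A) * tau ^+ 2)); last by ring.
rewrite [leRHS](_ : _ = T * (F * M * A * (1 + A) * tau ^+ 2)); last by ring.
rewrite ler_wpM2r ?mulr_ge0 ?sqr_ge0 ?addr_ge0//.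
exact/tT/ltnW.
Qed.

End ExactSteps.

(** * The error estimate *)

Section Reconstruction.
Context {R : realType}.

(** The sum of all constants to which [scheme_error] applies; each is at most the sum
    since all are nonnegative.  The term [T ^+ 2] bounds the noise level, as
    [tau <= T]. *)
Definition data_constant (T A l p F M B : R) : R :=
  A + l + B + M + p + (density_bound T F M B + T ^+ 2) + F
  + l * mass_lip T A F M B
  + (l * mass_lip T A F M B * density_bound T F M B + A * density_lip T A F M B)
  + (F * M * (1 + A) + T * F * M * A * (1 + A)).

Lemma le_data_constant (T A l p F M B : R) (H := data_constant T A l p F M B) :
  0 <= T -> 0 <= A -> 0 <= l -> 0 <= p -> 0 <= F -> 0 <= M -> 0 <= B ->
  [/\ [/\ 0 <= H, A <= H, l <= H, B <= H & M <= H], [/\ p <= H, F <= H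
    & density_bound T F M B + T ^+ 2 <= H],
    l * mass_lip T A F M B <= H,
    l * mass_lip T A F M B * density_bound T F M B + A * density_lip T A F M B <= H
    & F * M * (1 + A) + T * F * M * A * (1 + A) <= H].
Proof.
move=> T0 A0 l0 p0 F0 M0 B0.
have h1 : 0 <= density_bound T F M B by rewrite /density_bound addr_ge0// !mulr_ge0.
have h2 : 0 <= mass_lip T A F M B by rewrite /mass_lip addr_ge0// mulr_ge0.
have h3 : 0 <= density_lip T A F M B by rewrite /density_lip !addr_ge0// !mulr_ge0.
have h4 : 0 <= density_bound T F M B + T ^+ 2 by rewrite addr_ge0// sqr_ge0.
have h5 : 0 <= l * mass_lip T A F M B by rewrite mulr_ge0.
have h6 : 0 <= l * mass_lip T A F M B * density_bound T F M B + A * density_lip T A F M B.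
  by apply: addr_ge0; apply: mulr_ge0.
have h7 : 0 <= F * M * (1 + A) + T * F * M * A * (1 + A).
  by rewrite addr_ge0// !mulr_ge0// addr_ge0.
rewrite /H /data_constant; clear H h1 h2 h3; move: h4 h5 h6 h7.
set c1 := density_bound _ _ _ _ + _; set c2 := l * mass_lip _ _ _ _ _.
set c3 := c2 * _ + _; set c4 := F * M * _ + _.
by clearbody c3 c4 c2 c1 => h4 h5 h6 h7; split; [split|split| | |]; lra.
Qed.

Lemma noise_level_bound (T sigma : R) (g gs : R -> R) t :
  noise_level T g gs = sigma%:E -> 0 <= t <= T -> `|g t - gs t| <= sigma.
Proof.
move=> h tT; rewrite -lee_fin -h; apply: ereal_sup_ubound.
by exists t => //=; rewrite in_itv.
Qed.

Lemma scheme_xi_step (T L : R) (V kbar : R -> R) phi ks N (xi delta : nat -> R) n :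
  explicit_scheme T L V kbar phi ks N xi delta -> (n < N)%N ->
  xi n.+1 - xi n = Vplus V (delta n / L) * time_step T N.
Proof.
move=> sch nN; rewrite (scheme_xi sch) ?nN// big_nat_recr//=.
case: n nN => [|n] nN; first by rewrite big_geq// (scheme_xi0 sch) add0r subr0.
by rewrite (scheme_xi sch) ?(ltnW nN)// addrAC subrr add0r.
Qed.

Lemma scheme_delta_mul (T L : R) (V kbar : R -> R) phi ks N (xi delta : nat -> R) n :
  explicit_scheme T L V kbar phi ks N xi delta -> (1 <= n <= N)%N ->
  phi (time T N n) 0 != 0 ->
  phi (time T N n) 0 * delta n = ks (time T N n) - kbar (xi n) + delta 0%N * phi 0 (xi n)
    - \sum_(0 <= m < n) Vplus V (delta m / L) * ks (time T N m)
        * phi (time T N m) (xi n - xi m) * time_step T N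
    + \sum_(0 <= m < n) delta m * (phi (time T N m.+1) (xi n - xi m.+1)
        - phi (time T N m) (xi n - xi m)).
Proof.
move=> sch nN p0; rewrite (scheme_delta sch nN) (scheme_delta0 sch).
by rewrite mulrDr mulrBr !mulrA divff// !mul1r.
Qed.

End Reconstruction.

Theorem theorem4p1 (R : realType) (T L : R) (V : R -> R)
    (T_gt0 : 0 < T) (L_gt0 : 0 < L)
    (V_bounded : [bounded V s | s in halfline])
    (V_lipschitz : [lipschitz V s | s in halfline])
    (V_ge0 : forall s, 0 <= s -> 0 <= V s) :
  exists C : R -> R -> R -> R -> R -> R,
  forall (kbar : R -> R) (phi : R -> R -> R) (f : R -> R) (k : R -> R -> R)
         (ks : R -> R) (sigma : R) (N : nat) (xi delta : nat -> R),
    Linfty leb halfline kbar ->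
    (forall x, 0 <= x -> 0 <= kbar x) ->
    C2_halfline kbar ->
    (forall x, L < x -> kbar x = 0) ->
    Linfty leb2 (strip T) (fun z => phi z.1 z.2) ->
    (forall t x, 0 <= t <= T -> 0 <= x -> 0 <= phi t x) ->
    C2_strip T phi ->
    (forall t x, 0 <= t <= T -> L < x -> phi t x = 0) ->
    (forall t, 0 <= t <= T ->
       (\int[leb]_(x in halfline) (phi t x)%:E = 1)%E) ->
    (forall t, 0 <= t <= T -> 0 < phi t 0) ->
    Linfty leb `[0, T] f ->
    (\forall t \ae leb, 0 <= t <= T -> 0 <= f t) ->
    strong_solution T L V f phi kbar k ->
    noise_level T (k^~ 0) ks = sigma%:E ->
    (0 < N)%N ->
    explicit_scheme T L V kbar phi ks N xi delta ->
    time_step T N = Num.sqrt sigma ->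
    \big[Num.max/0]_(n < N)
       `| inflow_rec T L V ks N delta n
          - (time_step T N)^-1
            * \int[leb]_(t in `[time T N n, time T N n.+1]) f t |
    <= C (total_mass kbar) (phi_min0 T phi)^-1
         (fine (Linfty_norm leb `[0, T] f))
         (fine (W2infty_strip T phi)) (fine (W2infty_halfline kbar))
       * Num.sqrt sigma.
Proof.
have [A [l [A0 l0 v_bound v_lip]]] := velocity_data L_gt0 V_bounded V_lipschitz V_ge0.
exists (fun _ p F M B => scheme_constant T (data_constant T A l p F M B)).
move=> kbar phi f k ks sigma N xi delta _ _ kbar_C2 kbar_supp _ _ phi_C2 phi_supp
  phi_mass phi_pos f_Linf _ [k_lipschitz initial equation] noise N0 scheme tauE.
set p := (phi_min0 T phi)^-1; set F := fine _; set M := fine _; set B := fine _.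
set tau := time_step T N in tauE *.
have [B0 kbar_bound kbar_lip kbar_lip2] := halfline_data L_gt0 kbar_C2 kbar_supp.
have [M0 phi_bound phi_lip phi_lip2] := strip_data T_gt0 L_gt0 phi_C2 phi_supp.
rewrite -/B in B0 kbar_bound kbar_lip kbar_lip2; rewrite -/M in M0 phi_bound phi_lip phi_lip2.
have [K K0 k_lip] := strip_lipschitz k_lipschitz.
have [fc [F0 fc_meas fc_bound fcE fc_int]] := truncated_inflow f_Linf.
rewrite -/F in F0 fc_bound.
have phi_cont : {within strip T, continuous (fun z : R * R => phi z.1 z.2)} by case: phi_C2.
have p_ge1 t := @phi_min_pos R T phi t T_gt0 phi_cont phi_pos.
have [D [D0 D_cont D_id trace_id]] := solution_identities T_gt0 L_gt0 K0 M0 A0 l0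
  v_bound v_lip k_lip phi_bound phi_lip phi_supp phi_mass kbar_supp initial
  fc_meas fc_bound fcE equation.
have NR0 : 0 < N%:R :> R by rewrite ltr0n.
have tau_gt0 : 0 < tau by rewrite /tau /time_step divr_gt0.
have tau0 := ltW tau_gt0.
have NT : N%:R * tau = T by rewrite /tau /time_step mulrC divfK// gt_eqF.
have tauT : tau <= T by rewrite -NT ler_peMl// ler1n.
have T0 := ltW T_gt0.
have T00 : 0 <= (0 : R) <= T by rewrite lexx.
have sigma0 : 0 <= sigma by apply: le_trans (noise_level_bound noise T00).
have sigmaE : sigma = tau ^+ 2 by rewrite tauE sqr_sqrtr.
have [p0 _] := p_ge1 0 T00.
have [[H0 AH lH BH MH] [pH FH KMH] c1H c2H c3H] :=
  le_data_constant T0 A0 l0 p0 F0 M0 B0.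
rewrite -/p in p0 pH H0 AH lH BH MH FH KMH c1H c2H c3H p_ge1 *.
set H := data_constant T A l p F M B in H0 AH lH BH MH pH FH KMH c1H c2H c3H *.
have tT n : (n <= N)%N -> 0 <= time T N n <= T.
  move=> nN; rewrite /time -/tau; apply/andP; split; first exact: mulr_ge0.
  by rewrite -[leRHS]NT ler_wpM2r// ler_nat.
have tle n : time T N n <= time T N n.+1.
  by rewrite /time -/tau ler_wpM2r// ler_nat.
have tS n : time T N n.+1 - time T N n = tau by rewrite /time -/tau -natr1; ring.
pose trace t := k (clamp T t) 0.
have traceE t : 0 <= t <= T -> trace t = k t 0 by move=> ?; rewrite /trace clampE.
have trace_cont : continuous trace.
  apply: (@lipschitz_fun_continuous _ _ K) => s t.
  apply: le_trans (k_lip _ _ _ _ (clamp_itv _ T0) (clamp_itv _ T0) (lexx 0) (lexx 0)) _.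
  by rewrite subrr normr0 addr0 ler_wpM2l// clamp_lipschitz.
pose v s := Vplus V (s / L).
pose X := displacement (fun s => v (D s)).
have trace_id' t : 0 <= t <= T -> trace t = kbar (X t) +
    segint 0 t (fun s => fc s * phi (clamp T s) (pos (X t - X s))).
  by move=> tt; rewrite traceE//; exact: trace_id.
have trace_le n : (n <= N)%N -> `|trace (time T N n)| <= density_bound T F M B.
  move=> nN; apply: (trace_bound T_gt0 A0 F0 M0 v_bound v_lip fc_meas fc_bound kbar_bound
    phi_bound phi_lip D_cont trace_id'); exact: tT.
have noise_le n : (n <= N)%N -> `|ks (time T N n) - trace (time T N n)| <= tau ^+ 2.
  move=> nN; rewrite -sigmaE distrC traceE ?tT//.
  exact: (noise_level_bound noise (tT n nN)).
have t0E : time T N 0 = 0 by rewrite /time mul0r.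
have err n : (n < N)%N -> `|delta n.+1 - delta n + v (delta n) * ks (time T N n) * tau
    - segint (time T N n) (time T N n.+1) fc| <= scheme_constant T H * tau ^+ 2.
  apply: (@scheme_error R T tau H N v kbar phi delta xi (fun n => ks (time T N n))
    (fun n => D (time T N n)) (fun n => X (time T N n)) (fun n => trace (time T N n))
    (fun n => segint (time T N n) (time T N n.+1) fc)) => //.
  - by move=> s; have /andP[v0 vA] := v_bound s; rewrite v0 (le_trans vA).
  - by move=> s s'; apply: le_trans (v_lip _ _) _; rewrite ler_wpM2r.
  - by move=> x y x0 y0; apply: le_trans (kbar_lip _ _ x0 y0) _; rewrite ler_wpM2r.
  - move=> x y d x0 y0 d0; apply: le_trans (kbar_lip2 _ _ _ x0 y0 d0) _.
    by rewrite ler_wpM2r// ler_wpM2r.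
  - move=> s t x y sT tT' x0 y0; apply: le_trans (phi_lip _ _ _ _ sT tT' x0 y0) _.
    by rewrite ler_wpM2r// addr_ge0.
  - move=> s t x y d sT tT' x0 y0 d0; apply: le_trans (phi_lip2 _ _ _ _ _ sT tT' x0 y0 d0) _.
    by rewrite ler_wpM2r ?addr_ge0// ler_wpM2r.
  - move=> t tT'; have [_ /le_trans] := p_ge1 t tT'; apply.
    by rewrite ler_wpM2r// ltW// phi_pos.
  - move=> i iN; apply: le_trans KMH; rewrite addrC.
    have -> : ks (time T N i) = (ks (time T N i) - trace (time T N i)) + trace (time T N i) by ring.
    apply: le_trans (ler_normD _ _) _; apply: lerD; last exact: trace_le.
    by apply: le_trans (noise_le _ iN) _; rewrite lerXn2r ?nnegrE.
  - by move=> i iN; apply: le_trans (trace_le _ iN) _; apply: le_trans KMH; rewrite lerDl sqr_ge0.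
  - move=> i iN; apply: le_trans (_ : F * tau <= _); last by rewrite ler_wpM2r.
    rewrite -(tS i); apply: segint_bound; [|exact: tle|by move=> s _; exact: fc_bound].
    by split=> // a b; exists F.
  - exact: scheme_xi0 scheme.
  - by rewrite t0E /X /displacement segintxx.
  - by rewrite t0E D0 (scheme_delta0 scheme).
  - by rewrite t0E traceE// initial.
  - by move=> i iN; rewrite (scheme_xi_step scheme iN).
  - move=> i iN; have /andP[ti0 _] := tT _ (ltnW iN); have /andP[_ tiT] := tT _ iN.
    have := displacement_incr v_bound v_lip D_cont ti0 (tle _).
    have := displacement_step T_gt0 A0 l0 F0 M0 B0 v_bound v_lip fc_meas fc_bound kbar_bound
      phi_bound phi_lip trace_cont D_cont D_id trace_id' ti0 (tle _) tiT.
    rewrite tS => h1 /andP[h2 h3]; split.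
      by rewrite h2 (le_trans h3)// ler_wpM2r.
    by apply: le_trans h1 _; rewrite ler_wpM2r// sqr_ge0.
  - move=> i iN; have /andP[ti0 _] := tT _ (ltnW iN); have /andP[_ tiT] := tT _ iN.
    have := mass_step T_gt0 A0 l0 F0 M0 B0 v_bound v_lip fc_meas fc_bound kbar_bound kbar_lip
      phi_bound phi_lip trace_cont D_cont D_id trace_id' ti0 (tle _) tiT.
    by rewrite tS => /le_trans; apply; rewrite ler_wpM2r// sqr_ge0.
  - move=> i iN; have /andP[_ iN'] := iN.
    by apply: (scheme_delta_mul scheme iN); rewrite gt_eqF// phi_pos// tT.
  - move=> i iN.
    have := trace_step T_gt0 A0 F0 M0 v_bound v_lip fc_meas fc_bound
      phi_lip phi_lip2 D_cont trace_id' tau0 NT iN.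
    by move/le_trans; apply; rewrite ler_wpM2r// sqr_ge0.
have step n : (n < N)%N -> `| inflow_rec T L V ks N delta n
          - tau^-1 * \int[leb]_(t in `[time T N n, time T N n.+1]) f t |
    <= scheme_constant T H * Num.sqrt sigma.
  move=> nN; have /andP[tn0 _] := tT _ (ltnW nN); have /andP[_ tnT] := tT _ nN.
  rewrite -tauE -fc_int// /inflow_rec -/tau -/(v _).
  set G := segint _ _ _ in err *.
  rewrite (_ : _ - _ = tau^-1 * (delta n.+1 - delta n + v (delta n) * ks (time T N n) * tau - G)).
    rewrite normrM ger0_norm ?invr_ge0// ler_pdivrMl//.
    by apply: le_trans (err n nN) _; rewrite expr2 mulrCA.
  by field; rewrite gt_eqF.
apply: bigmax_le => [|i _]; last exact: step.
exact: le_trans (normr_ge0 _) (step 0%N N0).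
Qed.
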